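(* Let $\{(R_n,B_n)\}_{n=1}^\infty$ be a sequence of admissible pairs in $\mathbb{R}^d$. Suppose that (i) $\lim_{n\to\infty}\|R_1^{-1}R_2^{-1}\cdots R_n^{-1}\|=0$, and that there is a cube $C=t_0+[0,1]^d$ for some $t_0\in\mathbb{R}^d$ such that (ii) for each $n\ge1$, $R_n^{-1}(C+b)\subseteq C$ for every $b\in B_n$, and (iii) there is an admissible pair $(R,B)$ which occurs infinitely many times in the sequence $\{(R_n,B_n)\}$ such that $R^{-1}(C+b_0)\subseteq\operatorname{int}(C)$ for some $b_0\in B$. Then the infinite convolution $$\mu=\delta_{R_1^{-1}B_1}*\delta_{(R_2R_1)^{-1}B_2}*\cdots*\delta_{(R_n\cdots R_1)^{-1}B_n}*\cdots$$ exists (i.e., the finite convolutions $\mu_n=\delta_{R_1^{-1}B_1}*\cdots*\delta_{(R_n\cdots R_1)^{-1}B_n}$ converge weakly) and is a spectral measure with a spectrum contained in $\mathbb{Z}^d$.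
   Context: A Borel probability measure $\mu$ on $\mathbb{R}^d$ is a spectral measure if there is a countable set $\Lambda\subseteq\mathbb{R}^d$ (a spectrum) such that $\{e^{2\pi i\lambda\cdot x}:\lambda\in\Lambda\}$ is an orthonormal basis of $L^2(\mu)$. For a finite $A\subseteq\mathbb{R}^d$, $\delta_A=\frac{1}{\#A}\sum_{a\in A}\delta_a$. A pair $(R,B)$ with $R$ a $d\times d$ expanding integer matrix and $B\subseteq\mathbb{Z}^d$ finite is an admissible pair if there is a finite $L\subseteq\mathbb{Z}^d$ with $\#L=\#B$ such that $\big[\frac{1}{\sqrt{\#B}}e^{-2\pi i(R^{-1}b)\cdot\ell}\big]_{b\in B,\ell\in L}$ is unitary. *)

(* Defs.v *)
From HB Require Import structures.
From mathcomp Require Import all_boot all_order all_algebra all_field.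
From mathcomp Require Import all_classical all_reals all_analysis.

Set Implicit Arguments.
Unset Strict Implicit.
Unset Printing Implicit Defensive.

Import Order.TTheory GRing.Theory Num.Theory.
Import numFieldNormedType.Exports.

Local Open Scope classical_set_scope.
Local Open Scope ring_scope.

Section SpectralDefs.
Variables (R : realType) (d : nat).

(* R^d is represented by column vectors 'cV[R]_d, so that a matrix M acts
   by x |-> M *m x as in the paper. *)
Definition vecR := 'cV[R]_d.

Definition borelRd := g_sigma_algebraType (@open vecR).

Definition intmx (M : 'M[int]_d) : 'M[R]_d := map_mx (fun z : int => z%:~R) M.
Definition intv (b : 'cV[int]_d) : vecR := map_mx (fun z : int => z%:~R) b.

Definition dotR (x y : vecR) : R := \sum_(i < d) x i ord0 * y i ord0.

Definition expanding (M : 'M[int]_d) : Prop :=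
  forall z : algC, root (char_poly (map_mx (fun k : int => k%:~R) M)) z -> 1 < `|z|.

(* Admissible pair (M, B).  B is a finite subset of Z^d, given as a
   duplicate-free nonempty list.  The matrix
     H = [ #B^{-1/2} exp(-2 pi i (M^{-1} b) . l) ]_{b in B, l in L}
   is unitary, i.e. H H^* = I and H^* H = I; the entries of these products
   are written out through their real and imaginary parts. *)
Definition phase (M : 'M[int]_d) (b l : 'cV[int]_d) : R :=
  2 * pi * dotR (invmx (intmx M) *m intv b) (intv l).

Definition admissible (M : 'M[int]_d) (B : seq 'cV[int]_d) : Prop :=
  [/\ expanding M, uniq B, (0 < size B)%N &
  exists L : seq 'cV[int]_d,
    [/\ uniq L, size L = size B,
     (* H H^* = I *)
     (forall b b', b \in B -> b' \in B ->
        (size B)%:R^-1 * \sum_(l <- L) cos (phase M b' l - phase M b l)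
          = (if b == b' then 1 else 0)
        /\ (size B)%:R^-1 * \sum_(l <- L) sin (phase M b' l - phase M b l) = 0) &
     (* H^* H = I *)
     (forall l l', l \in L -> l' \in L ->
        (size B)%:R^-1 * \sum_(b <- B) cos (phase M b l - phase M b l')
          = (if l == l' then 1 else 0)
        /\ (size B)%:R^-1 * \sum_(b <- B) sin (phase M b l - phase M b l') = 0)]].

(* The sequence of pairs is indexed from 0: (Rs k, Bs k) = (R_{k+1}, B_{k+1}).
   cumR n = R_n ... R_1 (as a real matrix), cumR 0 = identity. *)
Fixpoint cumR (Rs : nat -> 'M[int]_d) (n : nat) : 'M[R]_d :=
  if n is k.+1 then intmx (Rs k) *m cumR Rs k else 1%:M.

(* Support points (with multiplicity) of the finite convolution
   mu_n = delta_{R_1^{-1}B_1} * ... * delta_{(R_n...R_1)^{-1}B_n}: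
   all sums  sum_{k<n} (R_{k+1}...R_1)^{-1} b_k  with b_k in B_{k+1}. *)
Fixpoint conv_pts (Rs : nat -> 'M[int]_d) (Bs : nat -> seq 'cV[int]_d)
    (n : nat) : seq vecR :=
  if n is k.+1 then
    [seq x + invmx (cumR Rs k.+1) *m intv b | x <- conv_pts Rs Bs k, b <- Bs k]
  else [:: 0].

Definition conv_integral (Rs : nat -> 'M[int]_d) (Bs : nat -> seq 'cV[int]_d)
    (n : nat) (f : vecR -> R) : R :=
  (size (conv_pts Rs Bs n))%:R^-1 * \sum_(x <- conv_pts Rs Bs n) f x.

Definition conv_weakly_to (Rs : nat -> 'M[int]_d) (Bs : nat -> seq 'cV[int]_d)
    (mu : probability borelRd R) : Prop :=
  forall f : vecR -> R, continuous f -> (exists M : R, forall x, `|f x| <= M) ->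
    (fun n => (conv_integral Rs Bs n.+1 f)%:E) @ \oo -->
      (\int[mu]_x (f x)%:E)%E.

Definition L2R (mu : probability borelRd R) (u : borelRd -> R) : Prop :=
  measurable_fun setT u /\ mu.-integrable setT (fun x => (u x ^+ 2)%:E).

(* {e_lambda : lambda in Lam}, e_lambda(x) = exp(2 pi i lambda . x), is an
   orthonormal basis of L^2(mu) (complex valued):  orthonormality, and
   completeness (the only f = u + i v in L^2(mu) orthogonal to every
   e_lambda is 0 mu-a.e.).  Complex integrals are split into real and
   imaginary parts. *)
Definition orthonormal_basis_exp (mu : probability borelRd R) (Lam : set vecR)
  : Prop :=
  (forall l l', Lam l -> Lam l' ->
     (\int[mu]_x (cos (2 * pi * dotR (l - l') x))%:E)%E
        = (if l == l' then 1 else 0)%:E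
     /\ (\int[mu]_x (sin (2 * pi * dotR (l - l') x))%:E)%E = 0%E)
  /\
  (forall u v : borelRd -> R, L2R mu u -> L2R mu v ->
     (forall l, Lam l ->
        (\int[mu]_x (u x * cos (2 * pi * dotR l x)
                     + v x * sin (2 * pi * dotR l x))%:E)%E = 0%E
        /\ (\int[mu]_x (v x * cos (2 * pi * dotR l x)
                     - u x * sin (2 * pi * dotR l x))%:E)%E = 0%E) ->
     {ae mu, forall x, u x = 0} /\ {ae mu, forall x, v x = 0}).

Definition spectral_with_integer_spectrum (mu : probability borelRd R) : Prop :=
  exists Lam : set vecR,
    countable Lam
    /\ (forall l, Lam l -> exists z : 'cV[int]_d, l = intv z)
    /\ orthonormal_basis_exp mu Lam.

Definition cube (t0 : vecR) : set vecR :=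
  [set x | forall i : 'I_d, t0 i ord0 <= x i ord0 <= t0 i ord0 + 1].

Definition contr (M : 'M[int]_d) (b : 'cV[int]_d) (x : vecR) : vecR :=
  invmx (intmx M) *m (x + intv b).

End SpectralDefs.

(* Main.v *)
Require Import Defs.
From HB Require Import structures.
From mathcomp Require Import all_boot all_order all_algebra all_field.
From mathcomp Require Import all_classical all_reals all_analysis.
From mathcomp Require Import measurable_realfun complex ring lra zify.

Set Implicit Arguments.
Unset Strict Implicit.
Unset Printing Implicit Defensive.

Import Order.TTheory GRing.Theory Num.Theory.
Import numFieldNormedType.Exports.

Local Open Scope classical_set_scope.
Local Open Scope ring_scope.

(** Realise [mu] as the law of [X = lim Xn] on the unit interval, where [Xn] is
    read off the mixed-radix digits of a uniform variable; condition (ii) makes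
    the cells [Xn + (R_n ... R_1)^{-1} C] nested, so [Xn] converges uniformly.

    The level-[n] convolution has the finite spectrum
    [L_1 + R_1^T L_2 + ... + (R_{n-1} ... R_1)^T L_n], and it keeps having a
    spectrum when each frequency is shifted by an element of
    [(R_n ... R_1)^T Z^d].  At the levels where [(R, B)] occurs, the tail of the
    convolution lives in the cube [C] and puts mass at least [1/#B] on a set that
    stays away from the boundary of [C]; since [C] meets the integer translates
    of an interior point only once, some integer shift of any frequency makes the
    Fourier transform of the tail at least a fixed [eps].  Choosing the shifts so
    gives increasing finite spectra along a subsequence of levels, whose union is
    the spectrum of [mu].

    For completeness, the Fourier coefficients of a function of the first digits
    factor through the tail, so the lower bound [eps] dominates the finite
    Parseval identities by the limit coefficients and they pass to the limit.
    Hence every such cylinder function is an L^2-limit of trigonometric sums over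
    the spectrum, and cylinder functions determine the integrals over [X in U]
    for [U] open. *)

(** The union of nested finite spectra is orthonormal for the limit at no cost. The difficulty is
    completeness: in the limit of the finite Parseval identities, mass may escape to ever larger
    frequencies. This is why the tail transform must be bounded below on all frequencies of a level
    with one and the same [eps]. Frequencies chosen earlier may no longer be shifted, since the
    spectra must stay nested; they are safe because, rescaled to a deep level, they tend to 0, where
    the tail transform is near 1. Infinite tails are never formed: a bound valid for every finite
    tail product replaces them.

    An integer shift sees the atoms of the tail only modulo Z^d, so atoms on opposite faces of the
    cube could be identified and cancel. The strict inclusion in (iii) supplies a definite mass for
    which this is excluded.

    On the digit space a cylinder function is a function of the digits by definition, even if the
    digits are not known to be determined by the point; overlapping cells thus need no separate
    treatment. *)

(** * Complex exponentials and squared moduli *)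

Section ComplexExponential.
Variable R : realType.
Implicit Types (s t : R) (z w : R[i]).

Definition cis t : R[i] := Complex (cos t) (sin t).

Definition nrm2 z : R := complex.Re z ^+ 2 + complex.Im z ^+ 2.

Lemma cisD s t : cis (s + t) = cis s * cis t.
Proof.
rewrite /cis cosD sinD [RHS]/GRing.mul /=; congr Complex.
by rewrite addrC (mulrC (sin s)).
Qed.

Lemma cis0 : cis 0 = 1.
Proof. by rewrite /cis cos0 sin0. Qed.

Lemma cisK t : cis t * cis (- t) = 1.
Proof. by rewrite -cisD subrr cis0. Qed.

Lemma cis_nat (n : nat) : cis (2 * pi * n%:R) = 1.
Proof.
elim: n => [|n IHn]; first by rewrite mulr0 cis0.
rewrite -[n.+1%:R]natr1 mulrDr cisD IHn mul1r mulr1 /cis.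
have -> : 2 * pi = pi + pi :> R by rewrite mulr2n mulrDl !mul1r.
by rewrite cosDpi sinDpi cospi sinpi opprK oppr0.
Qed.

Lemma cis_int (n : int) : cis (2 * pi * n%:~R) = 1.
Proof.
case: n => n; first exact: cis_nat.
rewrite NegzE mulrNz mulrN; have := cisK (2 * pi * n.+1%:R).
by rewrite cis_nat mul1r.
Qed.

Lemma nrm2M z w : nrm2 (z * w) = nrm2 z * nrm2 w.
Proof. by case: z w => [a b] [c e]; rewrite /nrm2 /=; ring. Qed.

Lemma nrm2_cis t : nrm2 (cis t) = 1.
Proof. exact: cos2Dsin2. Qed.

Lemma nrm2_ge0 z : 0 <= nrm2 z.
Proof. by rewrite addr_ge0 // sqr_ge0. Qed.

Lemma ReD z w : complex.Re (z + w) = complex.Re z + complex.Re w.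
Proof. by case: z w => [? ?] []. Qed.

Lemma ImD z w : complex.Im (z + w) = complex.Im z + complex.Im w.
Proof. by case: z w => [? ?] []. Qed.

Lemma Re_sum (I : Type) (r : seq I) (P : pred I) (F : I -> R[i]) :
  complex.Re (\sum_(i <- r | P i) F i) = \sum_(i <- r | P i) complex.Re (F i).
Proof. exact: (big_morph _ ReD). Qed.

Lemma Im_sum (I : Type) (r : seq I) (P : pred I) (F : I -> R[i]) :
  complex.Im (\sum_(i <- r | P i) F i) = \sum_(i <- r | P i) complex.Im (F i).
Proof. exact: (big_morph _ ImD). Qed.

Lemma complex_ext z w :
  complex.Re z = complex.Re w -> complex.Im z = complex.Im w -> z = w.
Proof. by case: z w => [? ?] [? ?] /= -> ->. Qed.

Lemma Re_realM (x : R) z : complex.Re (x%:C%C * z) = x * complex.Re z.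
Proof. by case: z => a b /=; rewrite mul0r subr0. Qed.

Lemma Im_realM (x : R) z : complex.Im (x%:C%C * z) = x * complex.Im z.
Proof. by case: z => a b /=; rewrite mul0r addr0. Qed.

Lemma natrC (n : nat) : n%:R = (n%:R : R)%:C%C :> R[i].
Proof. by rewrite rmorph_nat. Qed.

Lemma natVrC (n : nat) : n%:R^-1 = (n%:R^-1 : R)%:C%C :> R[i].
Proof. by rewrite fmorphV rmorph_nat. Qed.

Lemma nrm2E z : (nrm2 z)%:C%C = z * conjc z.
Proof.
case: z => a b; rewrite /nrm2 /=; apply: complex_ext => /=; ring.
Qed.

Lemma realC_sum (I : Type) (r : seq I) (F : I -> R) :
  (\sum_(i <- r) F i)%:C%C = \sum_(i <- r) (F i)%:C%C :> R[i].
Proof. exact: rmorph_sum. Qed.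

Lemma realCM (x y : R) : (x * y)%:C%C = x%:C%C * y%:C%C :> R[i].
Proof. exact: rmorphM. Qed.

Lemma conjcM z w : conjc (z * w) = conjc z * conjc w.
Proof. exact: rmorphM. Qed.

Lemma conjc_sum (I : Type) (r : seq I) (F : I -> R[i]) :
  conjc (\sum_(i <- r) F i) = \sum_(i <- r) conjc (F i).
Proof. exact: rmorph_sum. Qed.

Lemma nrm2_sum (I : Type) (r : seq I) (F : I -> R[i]) :
  (nrm2 (\sum_(i <- r) F i))%:C%C =
  \sum_(i <- r) \sum_(j <- r) F i * conjc (F j).
Proof.
rewrite nrm2E conjc_sum mulr_suml; apply: eq_bigr => i _; exact: mulr_sumr.
Qed.

Lemma conjc_cis t : conjc (cis t) = cis (- t).
Proof. by rewrite /cis cosN sinN. Qed.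

Lemma conjc_real (x : R) : conjc x%:C%C = x%:C%C.
Proof. by rewrite /= oppr0. Qed.

Lemma nrm2_natV (n : nat) z : nrm2 (n%:R^-1 * z) = n%:R ^- 2 * nrm2 z.
Proof. by rewrite nrm2M natVrC /nrm2 /= expr0n /= addr0 exprVn. Qed.

End ComplexExponential.

(** * Finite convolutions in mixed-radix indexing, and their spectra *)

Lemma big_nat_mulDr (V : nmodType) (n b : nat) (F : nat -> V) :
  \sum_(0 <= j < n * b) F j =
  \sum_(0 <= j < n) \sum_(0 <= i < b) F (j * b + i)%N.
Proof.
elim: n => [|n IHn]; first by rewrite mul0n !big_geq.
rewrite big_nat_recr //= -IHn mulSnr (big_cat_nat (n := (n * b)%N)) ?leq_addr //=.
congr (_ + _); rewrite -{1}[(n * b)%N]add0n big_addn addnC addnK.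
by apply: eq_bigr => i _; rewrite addnC.
Qed.

Section Digits.
Variables (R : realType) (d : nat).
Variables (Rs : nat -> 'M[int]_d) (Bs : nat -> seq 'cV[int]_d).
Hypothesis Badm : forall n, admissible R (Rs n) (Bs n).

Local Notation vec := (vecR R d).
Local Notation cumR := (cumR R Rs).
Local Notation intv := (@intv R d).
Local Notation intmx := (@intmx R d).

Lemma dotRE (x y : vec) : dotR x y = (x^T *m y) ord0 ord0.
Proof. by rewrite mxE; apply: eq_bigr => i _; rewrite mxE. Qed.

Lemma dotRDl (x y z : vec) : dotR (x + y) z = dotR x z + dotR y z.
Proof. by rewrite -big_split; apply: eq_bigr => i _; rewrite mxE mulrDl. Qed.

Lemma dotRDr (x y z : vec) : dotR x (y + z) = dotR x y + dotR x z.
Proof. by rewrite -big_split; apply: eq_bigr => i _; rewrite mxE mulrDr. Qed.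

Lemma dotRNl (x y : vec) : dotR (- x) y = - dotR x y.
Proof. by rewrite -sumrN; apply: eq_bigr => i _; rewrite mxE mulNr. Qed.

Lemma dotRNr (x y : vec) : dotR x (- y) = - dotR x y.
Proof. by rewrite -sumrN; apply: eq_bigr => i _; rewrite mxE mulrN. Qed.

Lemma dotR0l (y : vec) : dotR 0 y = 0.
Proof. by rewrite /dotR big1 // => i _; rewrite mxE mul0r. Qed.

Lemma dotR0r (y : vec) : dotR y 0 = 0.
Proof. by rewrite /dotR big1 // => i _; rewrite mxE mulr0. Qed.

Lemma dotR_mull (A : 'M[R]_d) (x y : vec) : dotR (A^T *m x) y = dotR x (A *m y).
Proof. by rewrite !dotRE trmx_mul trmxK mulmxA. Qed.

Lemma dotRC (x y : vec) : dotR x y = dotR y x.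
Proof. by apply: eq_bigr => i _; rewrite mulrC. Qed.

Lemma dotR_int (a b : 'cV[int]_d) :
  dotR (intv a) (intv b) = (\sum_i a i ord0 * b i ord0)%:~R.
Proof.
by rewrite rmorph_sum; apply: eq_bigr => i _; rewrite !mxE -intrM.
Qed.

Definition expi (x y : vec) : R[i] := cis (2 * pi * dotR x y).

Lemma expiDl x y z : expi (x + y) z = expi x z * expi y z.
Proof. by rewrite /expi dotRDl mulrDr cisD. Qed.

Lemma expiDr x y z : expi x (y + z) = expi x y * expi x z.
Proof. by rewrite /expi dotRDr mulrDr cisD. Qed.

Lemma expi0l x : expi 0 x = 1.
Proof. by rewrite /expi dotR0l mulr0 cis0. Qed.

Lemma expi0r x : expi x 0 = 1.
Proof. by rewrite /expi dotR0r mulr0 cis0. Qed.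

Lemma expi_int a b : expi (intv a) (intv b) = 1.
Proof. by rewrite /expi dotR_int cis_int. Qed.

Lemma expiNr x y : expi x (- y) = expi (- x) y.
Proof. by rewrite /expi dotRNl dotRNr. Qed.

Lemma conjc_expi x y : conjc (expi x y) = expi (- x) y.
Proof. by rewrite conjc_cis /expi dotRNl mulrN. Qed.

Lemma nrm2_expi x y : nrm2 (expi x y) = 1.
Proof. exact: nrm2_cis. Qed.

Lemma intvD a b : intv (a + b) = intv a + intv b.
Proof. by apply/matrixP => i j; rewrite !mxE intrD. Qed.

Lemma intvN a : intv (- a) = - intv a.
Proof. by apply/matrixP => i j; rewrite !mxE mulrNz. Qed.

Lemma intvB a b : intv (a - b) = intv a - intv b.
Proof. by rewrite intvD intvN. Qed.

Lemma intv0 : intv 0 = 0.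
Proof. by apply/matrixP => i j; rewrite !mxE. Qed.

Lemma intvM A a : intv (A *m a) = intmx A *m intv a.
Proof. exact: map_mxM. Qed.

Lemma intv_inj : injective intv.
Proof.
move=> a b /matrixP ab; apply/matrixP => i j; have := ab i j.
by rewrite !mxE => /eqP; rewrite eqr_int => /eqP.
Qed.

(** The determinant is, up to sign, the constant term of the characteristic polynomial, and 0 is not
    a root because every root has modulus above 1. *)
Lemma intmx_unit (M : 'M[int]_d) : expanding M -> intmx M \in unitmx.
Proof.
move=> expM; rewrite unitmxE unitfE det_map_mx intr_eq0.
apply/negP => /eqP detM0.
have /expM : root (char_poly (map_mx (fun k : int => k%:~R : algC) M)) 0.
  rewrite /root -[_.[0]]/(_.[0]) horner_coef0 char_poly_det.
  by rewrite det_map_mx detM0 mulr0.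
by rewrite normr0 ltr10.
Qed.

Lemma Rs_unit n : intmx (Rs n) \in unitmx.
Proof. by case: (Badm n) => /intmx_unit. Qed.

Lemma cumR_unit n : cumR n \in unitmx.
Proof.
by elim: n => [|n IHn]; rewrite /= ?unitmx1 // unitmx_mul Rs_unit.
Qed.

(** Integral form of [cumR], so that the shifts [cumT] have values in Z^d. *)
Fixpoint cumZ (n : nat) : 'M[int]_d :=
  if n is k.+1 then Rs k *m cumZ k else 1%:M.

Lemma cumZE n : intmx (cumZ n) = cumR n.
Proof.
elim: n => [|n /= <-]; last exact: map_mxM.
exact: map_mx1.
Qed.

Definition bsz k := size (Bs k).

Definition Nn n := (\prod_(0 <= k < n) bsz k)%N.

Lemma bsz_gt0 k : (0 < bsz k)%N.
Proof. by case: (Badm k). Qed.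

Lemma NnS n : Nn n.+1 = (Nn n * bsz n)%N.
Proof. by rewrite /Nn big_nat_recr. Qed.

Lemma Nn0 : Nn 0 = 1%N.
Proof. by rewrite /Nn big_geq. Qed.

Lemma Nn_gt0 n : (0 < Nn n)%N.
Proof. by rewrite /Nn prodn_gt0 // => k; apply: bsz_gt0. Qed.

(** The last mixed-radix digit of [j] selects the point of the last factor, so dividing [j] by
    [bsz k] forgets that factor. The same rule links the digits of a point of the unit interval at
    successive levels. *)
Fixpoint xpt (n j : nat) : vec :=
  if n is k.+1 then
    xpt k (j %/ bsz k) + invmx (cumR k.+1) *m intv (nth 0 (Bs k) (j %% bsz k))
  else 0.

Lemma xptS n j i : (i < bsz n)%N ->
  xpt n.+1 (j * bsz n + i) =
  xpt n j + invmx (cumR n.+1) *m intv (nth 0 (Bs n) i).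
Proof.
move=> ib /=; rewrite divnMDl ?bsz_gt0 // divn_small // addn0.
by rewrite modnMDl modn_small.
Qed.

Lemma size_conv_pts n : size (conv_pts R Rs Bs n) = Nn n.
Proof.
elim: n => [|n IHn]; first by rewrite Nn0.
by rewrite NnS /= size_allpairs IHn.
Qed.

Lemma sum_conv_pts (V : nmodType) (n : nat) (f : vec -> V) :
  \sum_(x <- conv_pts R Rs Bs n) f x = \sum_(0 <= j < Nn n) f (xpt n j).
Proof.
elim: n f => [|n IHn] f; first by rewrite Nn0 big_nat1 /= big_seq1.
rewrite NnS big_nat_mulDr /= big_allpairs_dep /= IHn.
apply: eq_bigr => j _; rewrite (big_nth 0); apply: eq_big_nat => i /andP[_ ib].
by rewrite -xptS.
Qed.

(** All matrices are integral, so [cumR n] clears the denominators of the atoms of level [n]. Hence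
    frequencies in the image of [cumT n] are trivial on these atoms. *)
Lemma cumR_xpt n j : exists a, cumR n *m xpt n j = intv a.
Proof.
elim: n j => [|n IHn] j; first by exists 0; rewrite mulmx0 intv0.
have [a aE] := IHn (j %/ bsz n)%N.
exists (Rs n *m a + nth 0 (Bs n) (j %% bsz n)).
rewrite [xpt _ _]/= mulmxDr mulKVmx ?cumR_unit // [cumR n.+1]/= -mulmxA aE.
by rewrite -intvM -intvD.
Qed.

Definition cumT n (l : 'cV[int]_d) : 'cV[int]_d := (cumZ n)^T *m l.

Lemma intv_cumT n l : intv (cumT n l) = (cumR n)^T *m intv l.
Proof. by rewrite intvM -cumZE; congr (_ *m _); rewrite /intmx map_trmx. Qed.

Lemma expi_cumT n l j : expi (intv (cumT n l)) (xpt n j) = 1.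
Proof.
rewrite intv_cumT /expi dotR_mull; have [a ->] := cumR_xpt n j.
exact: expi_int.
Qed.

Lemma cumT0 n : cumT n 0 = 0.
Proof. exact: mulmx0. Qed.

Lemma cumTB n : {morph cumT n : x y / x - y}.
Proof. by move=> x y; rewrite /cumT mulmxBr. Qed.

(** Against the transpose of [cumR n], the inverse of [cumR n.+1] reduces to the inverse of [Rs n];
    what remains is an entry of the matrix of the pair [(Rs n, Bs n)]. *)
Lemma expi_cumT_inv n l (b : 'cV[int]_d) :
  expi (intv (cumT n l)) (invmx (cumR n.+1) *m intv b) =
  cis (phase R (Rs n) b l).
Proof.
rewrite intv_cumT /expi dotR_mull /phase dotRC mulmxA; congr (cis (_ * dotR (_ *m _) _)).
have u := cumR_unit n; have v := Rs_unit n.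
have w := cumR_unit n.+1.
apply: (can_inj (mulKmx v)); rewrite mulmxA mulmxV //.
by rewrite -[intmx (Rs n) *m cumR n]/(cumR n.+1) mulmxV.
Qed.

(* [Lam] is a spectrum of the level-[n] convolution: the matrix of
   exponentials has orthogonal columns and orthogonal rows. *)
Definition Spec n (Lam : seq 'cV[int]_d) :=
  [/\ uniq Lam,
   (forall l l', l \in Lam -> l' \in Lam ->
     \sum_(0 <= j < Nn n) expi (intv l - intv l') (xpt n j) =
       (if l == l' then (Nn n)%:R else 0)) &
   (forall i i', (i < Nn n)%N -> (i' < Nn n)%N ->
     \sum_(l <- Lam) expi (intv l) (xpt n i - xpt n i') =
       (if i == i' then (Nn n)%:R else 0))].

Lemma Spec0 : Spec 0 [:: 0].
Proof.
split => //.
- move=> l l'; rewrite !inE => /eqP -> /eqP ->.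
  by rewrite eqxx Nn0 big_nat1 subrr expi0l.
- rewrite Nn0 => i i'; rewrite !ltnS !leqn0 => /eqP -> /eqP ->.
  by rewrite big_seq1 eqxx intv0 expi0l.
Qed.

(** The exponentials are unchanged on the atoms of level [n], so all sums are the old ones. That [k]
    may depend on the frequency is the freedom used later to make the tail transform large. *)
Lemma Spec_shift n Lam (k : 'cV[int]_d -> 'cV[int]_d) :
  Spec n Lam -> Spec n [seq l + cumT n (k l) | l <- Lam].
Proof.
case=> uL oL cL.
have exk l j : expi (intv (l + cumT n (k l))) (xpt n j) = expi (intv l) (xpt n j).
  by rewrite intvD expiDl expi_cumT mulr1.
have exNk l j :
    expi (- intv (l + cumT n (k l))) (xpt n j) = expi (- intv l) (xpt n j).
  by rewrite -!conjc_expi exk.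
have oL' l l' : l \in Lam -> l' \in Lam ->
    \sum_(0 <= j < Nn n) expi (intv (l + cumT n (k l)) - intv (l' + cumT n (k l')))
      (xpt n j) = (if l == l' then (Nn n)%:R else 0).
  move=> lL l'L; rewrite -oL //; apply: eq_bigr => j _.
  by rewrite [in LHS]expiDl exk exNk -expiDl.
(* If two shifted frequencies coincide, their sum is [Nn n], which orthogonality allows only when
   they were equal before the shift. *)
have inj_k : {in Lam &, injective (fun l => l + cumT n (k l))}.
  move=> l l' lL l'L ll'; apply/eqP; have := oL' l l' lL l'L; rewrite ll' subrr.
  under eq_bigr do rewrite expi0l.
  rewrite big_const_nat iter_addr_0 subn0; case: ifP => // _ /eqP.
  by rewrite pnatr_eq0 -leqn0 leqNgt Nn_gt0.
split.
- by rewrite map_inj_in_uniq.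
- move=> _ _ /mapP[l lL ->] /mapP[l' l'L ->]; rewrite oL' //.
  by rewrite (inj_in_eq inj_k).
- move=> i i' ib ib'; rewrite big_map -cL //; apply: eq_bigr => l _.
  by rewrite !expiDr expiNr exk exNk -expiNr.
Qed.

(** Translating a dual set by [- l0] multiplies each row of the unitary matrix by a unimodular
    constant and puts 0 into the set; this 0 is what makes successive spectra nested. *)
Lemma admissible_duals n : exists L : seq 'cV[int]_d,
  [/\ uniq L, 0 \in L,
   (forall l l', l \in L -> l' \in L ->
     \sum_(b <- Bs n) cis (phase R (Rs n) b (l - l')) =
       (if l == l' then (bsz n)%:R else 0)) &
   (forall b b', b \in Bs n -> b' \in Bs n ->
     \sum_(l <- L) cis (phase R (Rs n) (b - b') l) =
       (if b == b' then (bsz n)%:R else 0))].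
Proof.
have phBl b l l' : phase R (Rs n) b (l - l') =
    phase R (Rs n) b l - phase R (Rs n) b l'.
  by rewrite /phase intvB dotRDr dotRNr mulrBr.
have phBb b b' l : phase R (Rs n) (b - b') l =
    phase R (Rs n) b l - phase R (Rs n) b' l.
  by rewrite /phase intvB mulmxBr dotRDl dotRNl mulrBr.
case: (Badm n) => _ uB B0 [L [uL sL rowL colL]].
have nz : (size (Bs n))%:R != 0 :> R by rewrite pnatr_eq0 -lt0n.
case: L uL sL rowL colL => [|l0 L'] uL sL rowL colL.
  by move: B0; rewrite -sL.
set L := l0 :: L' in uL sL rowL colL.
have l0L : l0 \in L by rewrite mem_head.
exists [seq l - l0 | l <- L]; split.
- by rewrite map_inj_uniq //; apply: addIr.
- by apply/mapP; exists l0; rewrite ?subrr.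
- move=> _ _ /mapP[l lL ->] /mapP[l' l'L ->].
  rewrite (inj_eq (addIr _)) opprB addrA subrK.
  have [c s] := colL l l' lL l'L; apply: complex_ext.
  + rewrite Re_sum; under eq_bigr do rewrite phBl /=.
    apply: (mulfI (invr_neq0 nz)); rewrite c.
    by case: ifP => _; rewrite ?natrC /= ?mulr0 // mulVf.
  + rewrite Im_sum; under eq_bigr do rewrite phBl /=.
    apply: (mulfI (invr_neq0 nz)); rewrite s.
    by case: ifP => _; rewrite ?natrC /= ?mulr0.
- move=> b b' bB b'B; rewrite big_map.
  under eq_bigr do rewrite phBl cisD.
  rewrite -mulr_suml.
  suff -> : \sum_(l <- L) cis (phase R (Rs n) (b - b') l) =
      (if b == b' then (bsz n)%:R else 0).
    case: eqP => [->|_]; last by rewrite mul0r.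
    by rewrite phBb subrr oppr0 cis0 mulr1.
  have [c s] := rowL b' b b'B bB; apply: complex_ext.
  + rewrite Re_sum; under eq_bigr do rewrite phBb /=.
    apply: (mulfI (invr_neq0 nz)); rewrite c eq_sym.
    by case: ifP => _; rewrite ?natrC /= ?mulr0 // mulVf.
  + rewrite Im_sum; under eq_bigr do rewrite phBb /=.
    apply: (mulfI (invr_neq0 nz)); rewrite s.
    by case: ifP => _; rewrite ?natrC /= ?mulr0.
Qed.

(** The new spectrum is [Lam + cumT n L]. The second summand is invisible on the atoms of level [n],
    so sums of level [n.+1] split into a sum of level [n] and one over the new digit. *)
Lemma Spec_step n Lam : Spec n Lam ->
  exists2 Lam', Spec n.+1 Lam' & {subset Lam <= Lam'}.
Proof.
case=> uL oL cL; have [L [uD D0 oD cD]] := admissible_duals n.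
have sumex l l' h h' : l \in Lam -> l' \in Lam -> h \in L -> h' \in L ->
    \sum_(0 <= j < Nn n.+1)
       expi (intv (l + cumT n h) - intv (l' + cumT n h')) (xpt n.+1 j) =
      (if (l == l') && (h == h') then (Nn n.+1)%:R else 0).
  move=> lL l'L hL h'L; rewrite NnS big_nat_mulDr.
  pose S := \sum_(0 <= i < bsz n)
      expi (intv (l + cumT n h) - intv (l' + cumT n h'))
         (invmx (cumR n.+1) *m intv (nth 0 (Bs n) i)).
  rewrite (eq_bigr (fun j => expi (intv l - intv l') (xpt n j) * S)); last first.
    move=> j _; rewrite /S mulr_sumr; apply: eq_big_nat => i /andP[_ ib].
    rewrite xptS // expiDr; congr (_ * _).
    rewrite !intvD opprD addrACA -[intv (cumT n h) - _]intvB -cumTB.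
    by rewrite [LHS]expiDl expi_cumT mulr1.
  (* [S] does not depend on [j], and its value matters only for [l = l'], where it is a sum of the
     dual pair. *)
  rewrite -mulr_suml oL //; case: eqP => [ll'|_] /=; last by rewrite mul0r.
  suff -> : S = (if h == h' then (bsz n)%:R else 0).
    by case: ifP => _; rewrite ?natrM ?mulr0.
  rewrite -oD // /S [in RHS](big_nth 0); apply: eq_bigr => i _.
  by rewrite -ll' -intvB opprD addrACA subrr add0r -cumTB expi_cumT_inv.
have inj_h : {in Lam, forall l, {in Lam, forall l', {in L, forall h,
    {in L, forall h', l + cumT n h = l' + cumT n h' -> (l = l') /\ (h = h')}}}}.
  move=> l lL l' l'L h hL h' h'L e; have := sumex l l' h h' lL l'L hL h'L.
  rewrite e subrr; under eq_bigr do rewrite expi0l.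
  rewrite big_const_nat iter_addr_0 subn0; case: ifP => [/andP[/eqP-> /eqP->]//|_].
  by move/eqP; rewrite pnatr_eq0 -leqn0 leqNgt Nn_gt0.
exists [seq l + cumT n h | l <- Lam, h <- L]; last first.
  move=> l lL; apply/allpairsP; exists (l, 0).
  by split => //; rewrite cumT0 addr0.
split.
- apply: allpairs_uniq => // -[l h] [l' h'] /allpairsP[[a b] [/= aL bL [-> ->]]].
  move=> /allpairsP[[a' b'] [/= a'L b'L [-> ->]]] e.
  by have [-> ->] := inj_h _ aL _ a'L _ bL _ b'L e.
- move=> _ _ /allpairsP[[l h] /= [lL hL ->]] /allpairsP[[l' h'] /= [l'L h'L ->]].
  rewrite sumex //; case: (boolP (_ && _)) => [/andP[/eqP -> /eqP ->]|ne].
    by rewrite eqxx.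
  case: eqP => // e; have [ll' hh'] := inj_h _ lL _ l'L _ hL _ h'L e.
  by rewrite ll' hh' !eqxx in ne.
- move=> i i'; rewrite NnS => ib i'b; have b0 := bsz_gt0 n.
  rewrite big_allpairs_dep /= -/cumR.
  have rb k : (k %% bsz n < bsz n)%N by rewrite ltn_mod.
  pose j := (i %/ bsz n)%N; pose j' := (i' %/ bsz n)%N.
  have jN : (j < Nn n)%N by rewrite ltn_divLR.
  have j'N : (j' < Nn n)%N by rewrite ltn_divLR.
  set c := nth 0 (Bs n) (i %% bsz n); set c' := nth 0 (Bs n) (i' %% bsz n).
  have cB : c \in Bs n by rewrite mem_nth.
  have c'B : c' \in Bs n by rewrite mem_nth.
  pose z := invmx (cumR n.+1) *m intv (c - c').
  have -> : xpt n j + invmx (cumR n.+1) *m intv c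
      - (xpt n j' + invmx (cumR n.+1) *m intv c') = (xpt n j - xpt n j') + z.
    by rewrite /z intvB mulmxBr opprD addrACA.
  under eq_bigr => l _.
    under eq_bigr => h _.
      rewrite intvD expiDl [expi (intv (cumT n h)) _]expiDr.
      rewrite [expi (intv (cumT n h)) (_ - _)]expiDr expi_cumT mul1r.
      rewrite expiNr -conjc_expi expi_cumT conjc1 mul1r /z expi_cumT_inv.
      over.
    rewrite -mulr_sumr cD // expiDr -/z.
    over.
  (* The sum over [L] kills pairs with different last digits; equal last digits give [z = 0] and
     leave the relation of level [n]. *)
  rewrite -/z; case: eqP => [cc'|cc'].
    have -> : z = 0 by rewrite /z cc' subrr intv0 mulmx0.
    under eq_bigr do rewrite expi0r mulr1.
    rewrite -mulr_suml cL //.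
    suff -> : (j == j') = (i == i') by case: ifP => _; rewrite ?natrM ?mul0r.
    apply/eqP/eqP => [jj'|ii']; last by rewrite /j ii'.
    rewrite (divn_eq i (bsz n)) -/j jj'.
    rewrite [RHS](divn_eq i' (bsz n)); congr (_ + _)%N.
    case: (Badm n) => _ uB _ _; apply/eqP.
    by rewrite -(nth_uniq 0 _ _ uB) ?rb // -/c -/c' cc'.
  rewrite big1 => [|l _]; last by rewrite mulr0.
  by case: eqP => // ii'; case: cc'; rewrite /c /c' ii'.
Qed.

Lemma Spec_extend n m Lam : (n <= m)%N -> Spec n Lam ->
  exists2 Lam', Spec m Lam' & {subset Lam <= Lam'}.
Proof.
move=> /subnK <-; elim: (m - n)%N => [|k IHk] sL; first by exists Lam.
have [L1 sL1 sub1] := IHk sL; have [L2 sL2 sub2] := Spec_step sL1.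
by exists L2 => // l /sub1/sub2.
Qed.

(* The index, at level [m], of the cell containing the [j]-th point of level [k]. *)
Definition anc m k j := (j %/ \prod_(m <= i < k) bsz i)%N.

Lemma anc_id m j : anc m m j = j.
Proof. by rewrite /anc big_geq // divn1. Qed.

Lemma ancS m k j i : (m <= k)%N -> (i < bsz k)%N ->
  anc m k.+1 (j * bsz k + i) = anc m k j.
Proof.
move=> mk ib; rewrite /anc big_nat_recr //= [X in (_ %/ X)%N]mulnC divnMA.
by rewrite divnMDl ?bsz_gt0 // (divn_small ib) addn0.
Qed.

Lemma anc_step m k j : (m <= k)%N -> anc m k.+1 j = anc m k (j %/ bsz k)%N.
Proof. by move=> mk; rewrite /anc big_nat_recr //= mulnC divnMA. Qed.

Definition avg n (f : nat -> R) : R := (Nn n)%:R^-1 * \sum_(0 <= j < Nn n) f j.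

(* Fourier coefficient, in the level-[k] convolution, of the function [G] of the
   level-[m] cell. *)
Definition coefa m (G : nat -> R) (l : vec) k : R[i] :=
  (Nn k)%:R^-1 * \sum_(0 <= j < Nn k) (G (anc m k j))%:C%C * expi (- l) (xpt k j).

(* Fourier transform of the [k]-th factor of the convolution. *)
Definition Dk k (l : vec) : R[i] :=
  (bsz k)%:R^-1 * \sum_(b <- Bs k) expi (- l) (invmx (cumR k.+1) *m intv b).

Lemma Re_coefa m G (l : vec) k : complex.Re (coefa m G l k) =
  avg k (fun j => G (anc m k j) * cos (2 * pi * dotR (- l) (xpt k j))).
Proof.
rewrite /coefa natVrC Re_realM Re_sum; congr (_ * _).
by apply: eq_bigr => j _; rewrite Re_realM.
Qed.

Lemma Im_coefa m G (l : vec) k : complex.Im (coefa m G l k) =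
  avg k (fun j => G (anc m k j) * sin (2 * pi * dotR (- l) (xpt k j))).
Proof.
rewrite /coefa natVrC Im_realM Im_sum; congr (_ * _).
by apply: eq_bigr => j _; rewrite Im_realM.
Qed.

(** For [m <= k] the weight ignores the digit from [Bs k], which therefore enters only through the
    exponential and averages out to its own factor. *)
Lemma coefaS m G l k : (m <= k)%N -> coefa m G l k.+1 = coefa m G l k * Dk k l.
Proof.
move=> mk; rewrite /coefa NnS big_nat_mulDr natrM invfM /Dk mulrACA.
congr (_ * _); rewrite mulr_suml; apply: eq_bigr => j _.
rewrite [in RHS](big_nth 0) mulr_sumr; apply: eq_big_nat => i /andP[_ ib].
by rewrite ancS // xptS // expiDr mulrA.
Qed.

Lemma coefa_nrm2 m G l n len : (m <= n)%N ->
  nrm2 (coefa m G l (n + len)) =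
  nrm2 (coefa m G l n) * \prod_(n <= k < n + len) nrm2 (Dk k l).
Proof.
move=> mn; elim: len => [|len IHl]; first by rewrite addn0 big_geq // mulr1.
rewrite addnS coefaS; last exact: leq_trans (leq_addr _ _).
rewrite [LHS]nrm2M IHl.
by rewrite big_nat_recr ?leq_addr //= mulrA.
Qed.

(** All cells of level [m] have equally many descendants at level [k]. *)
Lemma avg_anc m k G : (m <= k)%N -> avg k (fun j => G (anc m k j)) = avg m G.
Proof.
move=> /subnK <-; elim: (k - m)%N => [|e IHe].
  by rewrite add0n; congr (_ * _); apply: eq_bigr => j _; rewrite anc_id.
rewrite -IHe /avg addSn NnS big_nat_mulDr natrM invfM -mulrA; congr (_ * _).
rewrite mulr_sumr; apply: eq_bigr => j _.
rewrite (eq_big_nat _ _ (F2 := fun=> G (anc m (e + m) j))); last first.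
  by move=> i /andP[_ ib]; rewrite ancS // leq_addl.
rewrite big_const_nat iter_addr_0 subn0 -[X in _ * X]mulr_natl mulKf //.
by rewrite pnatr_eq0 -lt0n bsz_gt0.
Qed.

(** The squares expand into a sum over pairs of atoms; summing over the frequencies first leaves the
    diagonal, by orthogonality of the rows. *)
Lemma parseval m n G Lam : (m <= n)%N -> Spec n Lam ->
  \sum_(l <- Lam) nrm2 (coefa m G (intv l) n) = avg m (fun j => G j ^+ 2).
Proof.
move=> mn [_ _ cL]; rewrite -(avg_anc _ mn).
apply: (can_inj (f := real_complex R) (g := @complex.Re R)); first by [].
rewrite realC_sum.
have N0 : (Nn n)%:R != 0 :> R[i] by rewrite pnatr_eq0 -lt0n Nn_gt0.
under eq_bigr => l _.
  rewrite /coefa nrm2_natV realCM nrm2_sum fmorphV rmorphXn rmorph_nat.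
  under eq_bigr => j _.
    under eq_bigr => j' _.
      rewrite conjcM conjc_real conjc_expi opprK mulrACA -realCM -expiNr -expiDr addrC.
      over.
    over.
  over.
rewrite -mulr_sumr /= exchange_big /=.
under eq_big_nat => j /andP[_ jN].
  rewrite exchange_big /=.
  under eq_big_nat => j' /andP[_ jN'].
    rewrite -mulr_sumr cL //.
    over.
  rewrite (bigD1_seq j) ?mem_index_iota ?iota_uniq //= eqxx big1 ?addr0; last first.
    by move=> i ij; rewrite (negbTE ij) mulr0.
  over.
rewrite /avg rmorphM /= fmorphV rmorph_nat rmorph_sum /= -mulr_suml.
by rewrite [X in _ * X]mulrC mulrA expr2 invfM -[_ / _ * _]mulrA mulVf ?mulr1.
Qed.

(** The coefficients [a] are arbitrary because the limit coefficients will be used at every finite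
    level; hence the cross term does not cancel against the squares. *)
Lemma avg_dist m N G Lam Lam' (a : 'cV[int]_d -> R[i]) :
  (m <= N)%N -> uniq Lam -> {subset Lam <= Lam'} -> Spec N Lam' ->
  avg N (fun j => nrm2 ((G (anc m N j))%:C%C
                        - \sum_(l <- Lam) a l * expi (intv l) (xpt N j))) =
  avg m (fun j => G j ^+ 2)
  + \sum_(l <- Lam) (nrm2 (a l)
      - 2 * complex.Re (conjc (a l) * coefa m G (intv l) N)).
Proof.
move=> mN uL sL [_ oL _]; rewrite -(avg_anc (fun j => G j ^+ 2) mN).
have N0 : (Nn N)%:R != 0 :> R by rewrite pnatr_eq0 -lt0n Nn_gt0.
pose g j : R[i] := (G (anc m N j))%:C%C.
pose h j := \sum_(l <- Lam) a l * expi (intv l) (xpt N j).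
have nB z w : nrm2 (z - w) = nrm2 z - 2 * complex.Re (conjc w * z) + nrm2 w :> R.
  by case: z w => [x y] [u v]; rewrite /nrm2 /=; ring.
have -> : avg N (fun j => nrm2 (g j - h j)) = avg N (fun j => G (anc m N j) ^+ 2)
    - 2 * avg N (fun j => complex.Re (conjc (h j) * g j)) + avg N (fun j => nrm2 (h j)).
  rewrite /avg (mulrCA 2) -mulrBr -mulrDr; congr (_ * _).
  rewrite mulr_sumr -sumrB -big_split; apply: eq_bigr => j _ /=.
  by rewrite nB; congr (_ - _ + _); rewrite /nrm2 /= expr0n addr0.
rewrite -addrA; congr (_ + _); rewrite sumrB addrC -mulr_sumr; congr (_ - 2 * _).
- apply: (can_inj (f := real_complex R) (g := @complex.Re R)); first by [].
  rewrite /avg rmorphM fmorphV rmorph_nat !rmorph_sum /=.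
  apply: (mulfI (x := (Nn N)%:R)); first by rewrite pnatr_eq0 -lt0n Nn_gt0.
  rewrite mulrA mulfV ?mul1r; last by rewrite pnatr_eq0 -lt0n Nn_gt0.
  under eq_bigr => j _.
    rewrite /h nrm2_sum.
    under eq_bigr => l _.
      under eq_bigr => l' _.
        rewrite conjcM conjc_expi mulrACA -expiDl.
        over.
      over.
    over.
  rewrite exchange_big mulr_sumr /=; apply: eq_big_seq => l lL.
  rewrite exchange_big /= (bigD1_seq l) //= [X in _ + X]big1_seq ?addr0.
    by rewrite -mulr_sumr oL ?eqxx ?sL // nrm2E mulrC.
  move=> l' /andP[l'l l'L]; rewrite -mulr_sumr oL ?sL //.
  by rewrite eq_sym (negbTE l'l) mulr0.
- rewrite /avg -Re_sum -[LHS]Re_realM -natVrC -Re_sum; congr complex.Re.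
  under eq_bigr do rewrite /h conjc_sum mulr_suml.
  rewrite exchange_big mulr_sumr /=; apply: eq_bigr => l _.
  rewrite /coefa [RHS]mulrCA [in RHS]mulr_sumr; congr (_ * _); apply: eq_bigr => j _.
  by rewrite conjcM conjc_expi -mulrA (mulrC (expi _ _)).
Qed.

End Digits.

(** * Elementary estimates and pigeonhole arguments *)

Section Elementary.
Variable R : realType.

Lemma cos_near1 (e : R) : 0 < e ->
  exists2 delta : R, 0 < delta & forall t, `|t| < delta -> 1 - e < cos t.
Proof.
move=> e0; have /cvgrPdist_lt/(_ e e0) := @continuous_cos R 0.
move=> /nbhs_ballP[delta /= delta0 H]; exists delta => // t td.
have /H : ball (0 : R) delta t by rewrite /ball /= sub0r normrN.
by rewrite cos0 /= => /(le_lt_trans (ler_norm _)); lra.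
Qed.

(** Here [t] keeps distance [rho] from -1, 0 and 1. Evenness and the reflection of [|t|] to
    [1 - |t|] reduce to [[rho, 1/2]], where the cosine decreases. *)
Lemma cos_far (rho t : R) : 0 < rho <= 4^-1 -> rho <= `|t| <= 1 - rho ->
  cos (2 * pi * t) <= cos (2 * pi * rho).
Proof.
move=> /andP[r0 r4] /andP[rt tr].
have pi0 : 0 < pi :> R := pi_gt0 R.
have mono (u : R) : rho <= u <= 2^-1 -> cos (2 * pi * u) <= cos (2 * pi * rho).
  move=> /andP[ru u2]; rewrite leNgt ltr_cos ?in_itv /=; first last.
  - by apply/andP; split; nra.
  - by apply/andP; split; nra.
  by rewrite -leNgt; nra.
have -> : cos (2 * pi * t) = cos (2 * pi * `|t|).
  by case: (ger0P t) => // _; rewrite mulrN cosN.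
case: (lerP `|t| 2^-1) => t2; first by apply: mono; rewrite rt.
suff -> : cos (2 * pi * `|t|) = cos (2 * pi * (1 - `|t|)).
  by apply: mono; apply/andP; split; lra.
have -> : 2 * pi * (1 - `|t|) = 2 * pi - 2 * pi * `|t| by rewrite mulrBr mulr1.
rewrite -[LHS]cosN; have := cis_nat R 1; rewrite mulr1 /cis => -[c s].
by rewrite [RHS]cosD c s mul1r mul0r subr0.
Qed.

Lemma expr_small (x e : R) : 0 <= x < 1 -> 0 < e -> exists q, x ^+ q < e.
Proof.
move=> /andP[x0 x1] e0.
have /cvgrPdist_lt/(_ e e0) : geometric 1 x n @[n --> \oo] --> 0.
  by apply: cvg_geometric; rewrite ger0_norm.
move=> [N _ /(_ N (leqnn _)) /=]; rewrite /geometric /= mul1r sub0r normrN.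
by rewrite ger0_norm ?exprn_ge0 // => H; exists N.
Qed.

Lemma sum_ge_ex (I : eqType) (s : seq I) (F : I -> R) (c : R) :
  c * (size s)%:R <= \sum_(i <- s) F i -> (0 < size s)%N ->
  exists2 i, i \in s & c <= F i.
Proof.
elim: s => // i s IHs; rewrite big_cons /= -natr1 mulrDr mulr1 => H _.
case: (lerP c (F i)) => [ci|Fi]; first by exists i; rewrite ?mem_head.
case: s IHs H => [|j s] IHs H.
  by move: H; rewrite big_nil mulr0 addr0 add0r leNgt Fi.
have [|//|k ks ck] := IHs; first by lra.
by exists k => //; rewrite inE ks orbT.
Qed.

Lemma nrm2_sum_cis_le (I : Type) (r : seq I) (t : I -> R) :
  nrm2 (\sum_(i <- r) cis (t i)) <= (size r)%:R ^+ 2.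
Proof.
rewrite -[nrm2 _]/(complex.Re (nrm2 _)%:C%C) nrm2_sum Re_sum.
have -> : (size r)%:R ^+ 2 = \sum_(i <- r) \sum_(j <- r) (1 : R).
  by rewrite !big_const_seq !count_predT !iter_addr_0 -mulrnA expr2 -natrM.
apply: ler_sum => i _; rewrite Re_sum; apply: ler_sum => j _.
by rewrite conjc_cis -cisD /=; apply: cos_le1.
Qed.

(** The default 1 of the minimum covers an empty index type, as for [d = 0]. *)
Lemma finmin_pos (I : finType) (g : I -> R) : (forall i, 0 < g i) ->
  exists2 r, 0 < r & forall i, r <= g i.
Proof.
move=> g0; exists (\big[Order.min/1]_i g i); last by move=> i; exact: bigmin_le.
by apply: lt_bigmin.
Qed.

Lemma count_fiber (T : Type) (I : finType) (i0 : I) (f : T -> I)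
    (K : pred T) (Z : seq T) :
  exists i, (count K Z <= #|I| * count (fun z => K z && (f z == i)) Z)%N.
Proof.
pose cnt i := count (fun z => K z && (f z == i)) Z.
have sumcnt : (\sum_i cnt i = count K Z)%N.
  rewrite {}/cnt; elim: Z => [|z Z IHZ] /=; first by rewrite big1.
  rewrite big_split /= IHZ; congr (_ + _)%N.
  case: (K z); last by rewrite big1.
  by rewrite (bigD1 (f z)) //= eqxx big1 // => i; rewrite eq_sym => /negbTE ->.
exists [arg max_(i > i0) cnt i]; rewrite -sumcnt.
case: arg_maxnP => // i _ imax; rewrite -sum_nat_const.
by apply: leq_sum => j _; apply: imax.
Qed.

End Elementary.

(** * Lower bound for exponential sums over points of a unit cube *)

Section Localization.
Variables (R : realType) (d : nat) (t0 : vecR R d).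
Local Notation vec := (vecR R d).
Local Notation intv := (@intv R d).

Lemma interior_cubeP x : interior (cube t0) x ->
  forall i, t0 i ord0 < x i ord0 < t0 i ord0 + 1.
Proof.
move=> /nbhs_ballP[e /= e0 xe] i.
have h2 : 0 < e / 2 by rewrite divr_gt0.
have b1 : ball (x : 'cV[R]_d) e (x - const_mx (e / 2)).
  split => // k j; rewrite /ball /= !mxE opprB addrC subrK gtr0_norm //.
  by lra.
have b2 : ball (x : 'cV[R]_d) e (x + const_mx (e / 2)).
  split => // k j; rewrite /ball /= !mxE opprD addrA subrr sub0r normrN gtr0_norm //.
  by lra.
have := xe _ b1 i; have := xe _ b2 i; rewrite !mxE; lra.
Qed.

(* Each coordinate of an affine map is extremal at a vertex of the cube, so no
   compactness argument is needed. *)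
Lemma affine_margin (A : 'M[R]_d) (w : vec) :
  (fun x => A *m (x + w)) @` cube t0 `<=` interior (cube t0) ->
  exists2 r : R, 0 < r & forall x i, cube t0 x ->
    t0 i ord0 + r <= (A *m (x + w)) i ord0 <= t0 i ord0 + 1 - r.
Proof.
move=> AC.
pose lo i : vec := \col_j (t0 j ord0 + (A i j < 0)%R%:R).
pose hi i : vec := \col_j (t0 j ord0 + (0 < A i j)%R%:R).
have loC i : cube t0 (lo i).
  by move=> j; rewrite mxE; case: (A i j < 0) => /=; apply/andP; split; lra.
have hiC i : cube t0 (hi i).
  by move=> j; rewrite mxE; case: (0 < A i j) => /=; apply/andP; split; lra.
have Alo i : t0 i ord0 < (A *m (lo i + w)) i ord0.
  by have /interior_cubeP/(_ i)/andP[] := AC _ (imageP (fun x => A *m (x + w)) (loC i)).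
have Ahi i : (A *m (hi i + w)) i ord0 < t0 i ord0 + 1.
  by have /interior_cubeP/(_ i)/andP[] := AC _ (imageP (fun x => A *m (x + w)) (hiC i)).
have [r1 r10 r1P] : exists2 r : R, 0 < r &
    forall i, r <= (A *m (lo i + w)) i ord0 - t0 i ord0.
  by apply: finmin_pos => i; rewrite subr_gt0.
have [r2 r20 r2P] : exists2 r : R, 0 < r &
    forall i, r <= t0 i ord0 + 1 - (A *m (hi i + w)) i ord0.
  by apply: finmin_pos => i; rewrite subr_gt0.
exists (Order.min r1 r2); first by rewrite lt_min r10.
move=> x i xC.
have m1 : Order.min r1 r2 <= r1 by rewrite ge_min lexx.
have m2 : Order.min r1 r2 <= r2 by rewrite ge_min lexx orbT.
have l1 : (A *m (lo i + w)) i ord0 <= (A *m (x + w)) i ord0.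
  rewrite !mxE; apply: ler_sum => j _; rewrite !mxE.
  have /andP[xj1 xj2] := xC j.
  case: (ltrP (A i j) 0) => /= Aij; nra.
have l2 : (A *m (x + w)) i ord0 <= (A *m (hi i + w)) i ord0.
  rewrite !mxE; apply: ler_sum => j _; rewrite !mxE.
  have /andP[xj1 xj2] := xC j.
  case: (ltrP 0 (A i j)) => /= Aij; nra.
have := r1P i; have := r2P i; lra.
Qed.

(* The zero frequencies make [kern] below nonnegative, so that its powers
   concentrate at the points of [Z^d]. *)
Definition base : seq 'cV[int]_d :=
  nseq (d.*2 + 8) 0 ++ [seq delta_mx i ord0 | i <- enum 'I_d]
    ++ [seq - delta_mx i ord0 | i <- enum 'I_d].

(** Normalised sum of the characters in [base], equal to 1 exactly on Z^d. Of the zero frequencies,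
    2d give nonnegativity; the other 8 keep [2 / size base] at most 1/4, so that [alpha] and [beta]
    in [localization] are not negative. *)
Definition kern (t : vec) : R :=
  1 - 2 / (size base)%:R * \sum_i (1 - cos (2 * pi * t i ord0)).

Lemma size_base : size base = (d.*2.*2 + 8)%N.
Proof.
by rewrite !size_cat size_nseq !(size_map _ (enum 'I_d)) size_enum_ord; lia.
Qed.

Lemma size_base_gt0 : (0 < size base)%N.
Proof. by rewrite size_base addnS. Qed.

Lemma kernE t : (size base)%:R^-1 * \sum_(s <- base) expi (intv s) t = (kern t)%:C%C.
Proof.
have dotd i : dotR (intv (delta_mx i ord0)) t = t i ord0.
  rewrite /dotR (bigD1 i) //= !mxE !eqxx mul1r big1 ?addr0 // => j ji.
  by rewrite !mxE (negbTE ji) mul0r.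
have b0 : (size base)%:R != 0 :> R by rewrite pnatr_eq0 -lt0n size_base_gt0.
have b0' : (size base)%:R != 0 :> R[i] by rewrite pnatr_eq0 -lt0n size_base_gt0.
apply: (mulfI b0'); rewrite mulrA mulfV // mul1r natrC -realCM.
rewrite /kern mulrBr mulr1 mulrA [_ * (2 / _)]mulrC divfK //.
rewrite !big_cat /= 2!big_map big_nseq.
have -> : iter (d.*2 + 8) (+%R (expi (intv 0) t)) 0 = (d.*2 + 8)%:R.
  by rewrite intv0 expi0l iter_addr_0.
rewrite -big_split /= big_enum /=.
rewrite (eq_bigr (fun i => (2 * cos (2 * pi * t i ord0))%:C%C)); last first.
  move=> i _; rewrite intvN -conjc_expi /expi dotd; apply: complex_ext => /=; ring.
rewrite -realC_sum natrC -raddfD /=; congr (_%:C%C).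
rewrite -mulr_sumr sumrB big_const cardE size_enum_ord iter_addr_0 size_base.
by rewrite -!addnn !natrD; ring.
Qed.

(** Repetitions are kept: after normalisation the multiplicities are the Fourier coefficients of
    [kern ^+ q]. *)
Fixpoint freqs (q : nat) : seq 'cV[int]_d :=
  if q is p.+1 then [seq k + s | k <- freqs p, s <- base] else [:: 0].

Lemma size_freqs q : size (freqs q) = (size base ^ q)%N.
Proof. by elim: q => //= q IHq; rewrite size_allpairs IHq expnSr. Qed.

Lemma size_freqs_gt0 q : (0 < size (freqs q))%N.
Proof. by rewrite size_freqs expn_gt0 size_base_gt0. Qed.

Lemma kernX q t :
  (size (freqs q))%:R^-1 * \sum_(k <- freqs q) expi (intv k) t = (kern t ^+ q)%:C%C.
Proof.
elim: q => [|q IHq]; first by rewrite /= big_seq1 intv0 expi0l invr1 mulr1 expr0.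
rewrite exprSr realCM -IHq -kernE size_freqs expnSr -size_freqs natrM invfM.
rewrite [RHS]mulrACA; congr (_ * _); rewrite /= big_allpairs_dep /= mulr_suml.
apply: eq_bigr => k _; rewrite mulr_sumr; apply: eq_bigr => s _.
by rewrite intvD expiDl.
Qed.

Lemma kern_ge0 t : 0 <= kern t.
Proof.
rewrite /kern subr_ge0.
have : \sum_i (1 - cos (2 * pi * t i ord0)) <= \sum_(i < d) (2 : R).
  by apply: ler_sum => i _; have := cos_geN1 (2 * pi * t i ord0); lra.
rewrite big_const cardE size_enum_ord iter_addr_0 => H.
rewrite mulrAC ler_pdivrMr ?mul1r; last by rewrite ltr0n size_base_gt0.
rewrite size_base; apply: le_trans (ler_wpM2l _ H) _ => //.
by rewrite -!addnn !natrD -mulr_natr; have := ler0n R d; lra.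
Qed.

Lemma kern_far (t : vec) (kappa : R) i : kappa <= 1 - cos (2 * pi * t i ord0) ->
  kern t <= 1 - 2 / (size base)%:R * kappa.
Proof.
move=> ki; rewrite /kern lerD2l lerN2 ler_wpM2l ?divr_ge0 ?ler0n //.
rewrite (bigD1 i) //= -[leLHS]addr0 lerD // sumr_ge0 //.
Qed.

Lemma kern_near (t : vec) (kappa : R) :
  (forall i, 1 - cos (2 * pi * t i ord0) <= kappa) ->
  1 - 2 / (size base)%:R * (d%:R * kappa) <= kern t.
Proof.
move=> ki; rewrite /kern lerD2l lerN2 ler_wpM2l ?divr_ge0 ?ler0n //.
have -> : d%:R * kappa = \sum_(i < d) kappa.
  by rewrite big_const cardE size_enum_ord iter_addr_0 mulr_natl.
exact: ler_sum.
Qed.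

Lemma dot_bound (xi t : vec) (u : R) : (forall i, `|xi i ord0| <= 1) ->
  (forall i, `|t i ord0| <= u) -> `|dotR xi t| <= d%:R * u.
Proof.
move=> xi1 tu; apply: le_trans (ler_norm_sum _ _ _) _.
have -> : d%:R * u = \sum_(i < d) u.
  by rewrite big_const cardE size_enum_ord iter_addr_0 mulr_natl.
by apply: ler_sum => i _; rewrite normrM -[leRHS]mul1r ler_pM.
Qed.

(* Test the sum against a power of [kern (z - c)], where [c] is a point of a
   small cell carrying a fixed proportion of the [K]-points: the power
   concentrates at [c] modulo the integers, and the margin [r] excludes the other
   integer translates of [c] from the cube. *)
Lemma localization (r c0 : R) : 0 < r -> 0 < c0 ->
  exists2 eps : R, 0 < eps & exists F : seq 'cV[int]_d,
  forall (Z : seq vec) (K : pred vec) (xi : vec),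
    (0 < size Z)%N ->
    (forall i, `|xi i ord0| <= 1) ->
    (forall z, z \in Z -> cube t0 z) ->
    (forall z i, K z -> t0 i ord0 + r <= z i ord0 <= t0 i ord0 + 1 - r) ->
    c0 * (size Z)%:R <= (count K Z)%:R ->
    exists2 k, k \in F &
      eps * (size Z)%:R ^+ 2 <= nrm2 (\sum_(z <- Z) expi (- (xi + intv k)) z).
Proof.
move=> r0 c00; have pi0 : 0 < pi :> R := pi_gt0 R.
have d10 : 0 < d%:R + 1 :> R by rewrite ltr_wpDl.
have [delta delta0 cosd] : exists2 delta : R, 0 < delta &
    forall t, `|t| < delta -> 2^-1 < cos t.
  have [|delta delta0 H] := @cos_near1 R 2^-1; first by rewrite invr_gt0.
  by exists delta => // t /H; lra.
(* [rho <= r] exploits the margin, [rho <= 1/4] is for [cos_far], and the last bound keeps the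
   cosine of the phase above 1/2 at points within [rho] of [c]. *)
have [rho rhoP] : exists rho : R,
    [/\ 0 < rho, rho <= r, rho <= 4^-1 & 2 * pi * (d%:R * rho) < delta].
  exists (Order.min r (Order.min 4^-1 (delta / (4 * pi * (d%:R + 1))))); split.
  - by rewrite !lt_min r0 invr_gt0 ltr0n divr_gt0 // !mulr_gt0.
  - by rewrite ge_min lexx.
  - by rewrite !ge_min lexx orbT.
  - set m := Order.min _ _.
    have m0 : 0 < m by rewrite !lt_min r0 invr_gt0 ltr0n divr_gt0 // !mulr_gt0.
    have : m <= delta / (4 * pi * (d%:R + 1)) by rewrite !ge_min lexx !orbT.
    rewrite ler_pdivlMr ?mulr_gt0 // => H.
    have d0 := ler0n R d.
    have : 0 < m * pi by rewrite mulr_gt0.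
    nra.
case: rhoP => rho0 rhor rho4 rhod.
pose kappa : R := 1 - cos (2 * pi * rho).
have kappa0 : 0 < kappa.
  rewrite subr_gt0 -[ltRHS]cos0 ltr_cos ?in_itv /=; last 2 first.
  - by rewrite lexx ltW.
  - by apply/andP; split; nra.
  by rewrite !mulr_gt0.
have kappa2 : kappa <= 2 by have := cos_geN1 (2 * pi * rho); rewrite /kappa; lra.
(* With this denominator the [d] coordinates together cost at most [kappa / 2]. *)
have [del2 del20 cosd2] : exists2 delta : R, 0 < delta &
    forall t, `|t| < delta -> 1 - cos t <= kappa / (2 * (d%:R + 1)).
  have [|del2 del20 H] := @cos_near1 R (kappa / (2 * (d%:R + 1))).
    by rewrite divr_gt0 // mulr_gt0.
  by exists del2 => // t /H; lra.
pose u : R := Order.min rho (del2 / (2 * pi)).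
have u0 : 0 < u by rewrite lt_min rho0 divr_gt0 // mulr_gt0.
(* Grid cells of side [1/p] are smaller than [rho] and fine enough for [cosd2]. *)
pose p := (Num.truncn u^-1).+1.
have p0 : 0 < p%:R :> R by rewrite ltr0n.
have pu : p%:R^-1 < u by rewrite invf_plt ?posrE // truncnS_gt.
have near_rho : p%:R^-1 < rho by rewrite (lt_le_trans pu) // ge_min lexx.
have near_del : 2 * pi * p%:R^-1 < del2.
  have : u <= del2 / (2 * pi) by rewrite ge_min lexx orbT.
  rewrite ler_pdivlMr ?mulr_gt0 //.
  have : 0 < (u - p%:R^-1) * pi by rewrite mulr_gt0 // subr_gt0.
  by nra.
pose eta : R := 2 / (size base)%:R.
have eta0 : 0 < eta by rewrite divr_gt0 // ltr0n size_base_gt0.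
have eta4 : eta <= 4^-1.
  rewrite ler_pdivrMr ?ltr0n ?size_base_gt0 // size_base natrD.
  by have := ler0n R d.*2.*2; lra.
(* [alpha] bounds [kern (z - c)] below on the cell of [c]; [beta] bounds it above once some
   coordinate of [z] is farther than [rho] from that of [c]. *)
pose alpha := 1 - eta * (kappa / 2); pose beta := 1 - eta * kappa.
have ek0 : 0 < eta * kappa by rewrite mulr_gt0.
have ek2 : eta * kappa <= 2^-1 by nra.
have beta0 : 0 <= beta by rewrite /beta; lra.
have ab : beta < alpha by rewrite /alpha /beta; lra.
have alpha0 : 0 < alpha by lra.
pose cells : finType := {ffun 'I_d -> 'I_p}.
have cells0 : 0 < #|cells|%:R :> R.
  by rewrite ltr0n card_ffun !card_ord expn_gt0.
pose c1 : R := c0 / #|cells|%:R.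
have c10 : 0 < c1 by rewrite divr_gt0.
(* Averaged over [Z], the cell gains [c1 / 2 * alpha ^+ q] and the far points lose at most
   [beta ^+ q]; this [q] keeps half of the gain. *)
have [q qP] : exists q, (beta / alpha) ^+ q < c1 / 4.
  apply: expr_small; last by rewrite divr_gt0.
  by rewrite (divr_ge0 beta0 (ltW alpha0)) /= ltr_pdivrMr // mul1r.
have aq0 : 0 < alpha ^+ q by rewrite exprn_gt0.
have bq : beta ^+ q <= c1 / 4 * alpha ^+ q.
  by rewrite -ler_pdivrMr // -expr_div_n ltW.
exists ((c1 / 4 * alpha ^+ q) ^+ 2); first by rewrite exprn_gt0 // mulr_gt0 // divr_gt0.
exists [seq - k | k <- freqs q] => Z K xi Z0 xi1 ZC KP KZ.
(* The margin puts the truncation below [p] on [K]-points, so [inord] does not fall back to its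
   default there. *)
pose cell (z : vec) : cells :=
  [ffun i => inord (Num.truncn (p%:R * (z i ord0 - t0 i ord0)))].
have cell_close z z' i : K z -> K z' -> cell z = cell z' ->
    `|z i ord0 - z' i ord0| <= p%:R^-1.
  move=> Kz Kz' /ffunP/(_ i); rewrite !ffunE.
  have small (y : vec) : K y ->
      0 <= p%:R * (y i ord0 - t0 i ord0) /\
      (Num.truncn (p%:R * (y i ord0 - t0 i ord0)) < p)%N.
    move=> /(KP _ i) Ky; have y0 : 0 <= p%:R * (y i ord0 - t0 i ord0).
      by apply: mulr_ge0; [exact: ltW|lra].
    split => //; rewrite truncn_lt_nat // -[ltRHS]mulr1 ltr_pM2l //; lra.
  have [zp zt] := small z Kz; have [zp' zt'] := small z' Kz'.
  move=> /(congr1 val); rewrite /= !inordK // => tE.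
  have := truncn_itv zp; have := truncn_itv zp'; rewrite tE => /andP[a1 a2] /andP[b1 b2].
  have : `|p%:R * (z i ord0 - z' i ord0)| <= 1.
    rewrite ler_norml; move: a1 a2 b1 b2; rewrite -natr1.
    set n := (Num.truncn _)%:R; move=> *; apply/andP; split; lra.
  by rewrite normrM gtr0_norm // -ler_pdivlMl // mulr1.
have [f fP] := count_fiber [ffun=> ord0 : 'I_p] cell K Z.
pose near z := K z && (cell z == f).
have nearZ : c1 * (size Z)%:R <= (count near Z)%:R.
  rewrite /c1 mulrAC ler_pdivrMr // (le_trans KZ) // mulrC -natrM ler_nat.
  exact: fP.
have [c cZ /andP[Kc /eqP cf]] : exists2 c, c \in Z & near c.
  apply/hasP; rewrite has_count -(ltr0n R); apply: lt_le_trans nearZ.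
  by rewrite mulr_gt0 // ltr0n.
pose T : R[i] := \sum_(z <- Z) expi (- xi) (z - c) * (kern (z - c) ^+ q)%:C%C.
have termP z : z \in Z -> (near z)%:R * (2^-1 * alpha ^+ q) - beta ^+ q <=
    complex.Re (expi (- xi) (z - c) * (kern (z - c) ^+ q)%:C%C).
  move=> zZ; rewrite [X in complex.Re X]mulrC Re_realM /expi /=.
  have bq0 : 0 <= beta ^+ q by rewrite exprn_ge0.
  have kq0 : 0 <= kern (z - c) ^+ q by rewrite exprn_ge0 // kern_ge0.
  set th := 2 * pi * dotR (- xi) (z - c).
  (* Within [rho] of [c] in all coordinates the term is nonnegative, and at least [alpha ^+ q / 2]
     on the cell; elsewhere it is at least [- beta ^+ q]. *)
  case: (pselect (forall i, `|(z - c) i ord0| <= rho)) => mid.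
    have cth : 2^-1 <= cos th.
      apply/ltW/cosd; rewrite /th normrM gtr0_norm ?mulr_gt0 //.
      apply: le_lt_trans rhod; rewrite ler_pM2l ?mulr_gt0 //.
      by apply: dot_bound => // i; rewrite mxE normrN.
    have kc : 2^-1 * kern (z - c) ^+ q <= kern (z - c) ^+ q * cos th.
      by rewrite mulrC ler_wpM2l.
    case: (boolP (near z)) => [/andP[Kz /eqP zf]|_]; last by rewrite mul0r; nra.
    rewrite mul1r.
    have : alpha ^+ q <= kern (z - c) ^+ q.
      rewrite lerXn2r ?nnegrE ?(ltW alpha0) ?kern_ge0 //.
      apply: le_trans (@kern_near _ (kappa / (2 * (d%:R + 1))) _).
        rewrite /alpha lerD2l lerN2 ler_pM2l //.
        rewrite mulrCA ler_pM2l // invfM mulrCA -[leRHS]mulr1 ler_pM2l ?invr_gt0 //.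
        by rewrite ler_pdivrMr // mul1r lerDl.
      move=> i; apply: cosd2; rewrite normrM gtr0_norm ?mulr_gt0 //.
      apply: le_lt_trans near_del; rewrite ler_pM2l ?mulr_gt0 //.
      by rewrite !mxE; apply: cell_close => //; rewrite zf cf.
    by lra.
  have [i /negP] : exists i, ~ (`|(z - c) i ord0| <= rho).
    exact/existsNP.
  rewrite -ltNge => ifar.
  have nz : near z = false.
    apply/negP => /andP[Kz /eqP zf]; move: ifar; apply/negP; rewrite -leNgt.
    rewrite (le_trans _ (ltW near_rho)) // !mxE.
    by apply: cell_close => //; rewrite zf cf.
  rewrite nz mul0r sub0r.
  have kb : kern (z - c) ^+ q <= beta ^+ q.
    rewrite lerXn2r ?nnegrE ?kern_ge0 //; apply: (kern_far (i := i)).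
    rewrite lerD2l lerN2; apply: cos_far; first by rewrite rho0.
    (* The cube has side 1 and [c] keeps distance [r] from its faces, so the difference is at most
       [1 - r] in modulus and approaches no nonzero integer. *)
    rewrite (ltW ifar) /= !mxE ler_norml.
    have := ZC z zZ i; have := KP c i Kc; lra.
  by have := cos_geN1 th; nra.
have ReT : c1 / 4 * alpha ^+ q * (size Z)%:R <= complex.Re T.
  rewrite Re_sum; apply: le_trans (_ : \sum_(z <- Z)
      ((near z)%:R * (2^-1 * alpha ^+ q) - beta ^+ q) <= _); last first.
    by rewrite big_seq [leRHS]big_seq; apply: ler_sum.
  rewrite sumrB -mulr_suml big_const_seq count_predT iter_addr_0.
  have -> : \sum_(z <- Z) (near z)%:R = (count near Z)%:R :> R.
    by rewrite -sumn_count -natr_sum sumnE big_map.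
  have : 0 <= (size Z)%:R :> R by [].
  rewrite -mulr_natr; set n := (size Z)%:R; move=> n0.
  have : c1 * n * (2^-1 * alpha ^+ q) <= (count near Z)%:R * (2^-1 * alpha ^+ q).
    by rewrite ler_pM2r // mulr_gt0.
  have : beta ^+ q * n <= c1 / 4 * alpha ^+ q * n by rewrite ler_wpM2r.
  by lra.
(* Expanding the power of [kern] makes [T] an average of shifted sums, each up to a unimodular
   factor at [c]; one of them reaches the average. *)
pose W k := expi (xi - intv k) c * \sum_(z <- Z) expi (- (xi - intv k)) z.
have TE : T = (size (freqs q))%:R^-1 * \sum_(k <- freqs q) W k.
  rewrite /T; under eq_bigr do rewrite -kernX mulrCA mulr_sumr.
  rewrite -mulr_sumr exchange_big /=; congr (_ * _); apply: eq_bigr => k _.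
  rewrite /W mulr_sumr; apply: eq_bigr => z _.
  rewrite -expiDl -[in LHS](opprK (intv k)) -opprD expiDr expiNr opprK mulrC.
  by [].
have [|k kF kP] := @sum_ge_ex R _ (freqs q) (fun k => complex.Re (W k))
    (c1 / 4 * alpha ^+ q * (size Z)%:R) _ (size_freqs_gt0 q).
  move: ReT; rewrite TE natVrC Re_realM Re_sum => ReT.
  by rewrite -ler_pdivlMr ?ltr0n ?size_freqs_gt0 // [leRHS]mulrC.
exists (- k); first exact: map_f.
rewrite intvN -exprMn.
have -> : nrm2 (\sum_(z <- Z) expi (- (xi - intv k)) z) = nrm2 (W k).
  by rewrite [RHS]nrm2M nrm2_expi mul1r.
apply: le_trans (_ : complex.Re (W k) ^+ 2 <= _); last by rewrite lerDl sqr_ge0.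
rewrite lerXn2r // nnegrE; last apply: le_trans kP.
  by rewrite !mulr_ge0 // ltW.
by rewrite !mulr_ge0 // ltW.
Qed.

End Localization.

(** * Uniform positivity of the tail transforms *)

Section EquiPositivity.
Variables (R : realType) (d : nat).
Variables (Rs : nat -> 'M[int]_d) (Bs : nat -> seq 'cV[int]_d) (t0 : vecR R d).
Hypothesis Badm : forall n, admissible R (Rs n) (Bs n).
Hypothesis Rcvg : (fun n => `| invmx (cumR R Rs n.+1) |) @ \oo --> (0 : R).
Hypothesis Ccontr :
  forall n b, b \in Bs n -> contr (Rs n) b @` cube t0 `<=` cube t0.

Local Notation vec := (vecR R d).
Local Notation cumR := (cumR R Rs).
Local Notation intv := (@intv R d).
Local Notation intmx := (@intmx R d).
Local Notation bsz := (bsz Bs).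
Local Notation Dk := (Dk Rs Bs).
Local Notation Spec := (Spec R Rs Bs).
Local Notation cumT := (cumT Rs).

Lemma cube_t0 : cube t0 t0.
Proof. by move=> i; rewrite lexx lerDl ler01. Qed.

(* Images of the corner [t0] under the compositions of contractions from level
   [n] to level [n + len]: up to a translation, the atoms of the tail of the
   convolution. *)
Fixpoint tail_pts (n len : nat) : seq vec :=
  if len is l.+1 then [seq contr (Rs n) b z | b <- Bs n, z <- tail_pts n.+1 l]
  else [:: t0].

Lemma tail_pts_cube n len z : z \in tail_pts n len -> cube t0 z.
Proof.
elim: len n z => [|len IHl] n z; first by rewrite inE => /eqP ->; exact: cube_t0.
move=> /allpairsP[[b y] /= [bB yT ->]]; apply: (Ccontr bB).
by exists y => //; apply: IHl yT.
Qed.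

Lemma size_tail_ptsS n len :
  size (tail_pts n len.+1) = (bsz n * size (tail_pts n.+1 len))%N.
Proof. by rewrite /= size_allpairs. Qed.

Lemma size_tail_pts_gt0 n len : (0 < size (tail_pts n len))%N.
Proof.
elim: len n => [|len IHl] n //.
by rewrite size_tail_ptsS muln_gt0 IHl (bsz_gt0 Badm).
Qed.

(** [(cumR n)^T *m xi] is the frequency seen from level 0, and [xi'] is the same frequency rescaled
    to level [n.+1]. The base point [t0] costs a unimodular factor, invisible in [nrm2]. *)
Lemma tail_pts_Dk n len (xi : vec) :
  nrm2 (\sum_(z <- tail_pts n len) expi (- xi) z) =
  (size (tail_pts n len))%:R ^+ 2 *
    \prod_(n <= k < n + len) nrm2 (Dk k ((cumR n)^T *m xi)).
Proof.
elim: len n xi => [|len IHl] n xi.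
  by rewrite addn0 big_geq // big_seq1 nrm2_expi expr1n mulr1.
have v := Rs_unit Badm n.
pose xi' := (invmx (intmx (Rs n)))^T *m xi.
have b0 : (bsz n)%:R != 0 :> R[i] by rewrite pnatr_eq0 -lt0n (bsz_gt0 Badm).
have -> : \sum_(z <- tail_pts n len.+1) expi (- xi) z =
    (bsz n)%:R * Dk n ((cumR n)^T *m xi) * \sum_(z <- tail_pts n.+1 len) expi (- xi') z.
  rewrite /= big_allpairs_dep /= /Dk mulrA mulfV // mul1r mulr_suml.
  apply: eq_bigr => b _; rewrite mulr_sumr; apply: eq_bigr => z _.
  rewrite /contr mulmxDr expiDr mulrC; congr (_ * _).
    rewrite /expi -!mulmxN dotR_mull mulmxA; congr (cis (_ * dotR _ (_ *m _))).
    apply: (can_inj (mulKmx v)); rewrite mulmxV // mulmxA.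
    by rewrite -[intmx (Rs n) *m cumR n]/(cumR n.+1) mulmxV // (cumR_unit Badm).
  by rewrite /xi' /expi -mulmxN dotR_mull.
rewrite [LHS]nrm2M [nrm2 (_ * Dk _ _)]nrm2M IHl size_tail_ptsS natrM exprMn addSnnS.
rewrite [in RHS]big_ltn; last by rewrite addnS ltnS leq_addr.
have -> : (cumR n.+1)^T *m xi' = (cumR n)^T *m xi.
  rewrite /xi' mulmxA -trmx_mul [cumR n.+1]/= mulKmx //.
have -> : nrm2 (bsz n)%:R = (bsz n)%:R ^+ 2 :> R.
  by rewrite natrC /nrm2 /= expr0n addr0.
exact: mulrACA.
Qed.

Lemma Dk_le1 k (l : vec) : nrm2 (Dk k l) <= 1.
Proof.
rewrite /Dk nrm2_natV -ler_pdivlMl ?invrK ?mulr1; last first.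
  by rewrite invr_gt0 exprn_gt0 // ltr0n (bsz_gt0 Badm).
exact: nrm2_sum_cis_le.
Qed.

Definition tail_prod n len (l : vec) : R := \prod_(n <= k < n + len) nrm2 (Dk k l).

Lemma tail_prod_mono n len len' l : (len <= len')%N ->
  tail_prod n len' l <= tail_prod n len l.
Proof.
move=> /subnK <-; elim: (len' - len)%N => [|e IHe] //.
rewrite addSn /tail_prod addnS big_nat_recr ?leq_addr //=.
apply: le_trans IHe; rewrite -[leRHS]mulr1 ler_wpM2l ?Dk_le1 //.
by apply: prodr_ge0 => k _; exact: nrm2_ge0.
Qed.

Lemma tail_prodE n len (xi : vec) :
  tail_prod n len ((cumR n)^T *m xi) =
  nrm2 (\sum_(z <- tail_pts n len) expi (- xi) z) / (size (tail_pts n len))%:R ^+ 2.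
Proof.
rewrite tail_pts_Dk mulrAC mulfV ?mul1r // expf_neq0 //.
by rewrite pnatr_eq0 -lt0n size_tail_pts_gt0.
Qed.

Lemma cumT_xi n (l : 'cV[int]_d) :
  intv l = (cumR n)^T *m ((invmx (cumR n))^T *m intv l).
Proof. by rewrite mulmxA -trmx_mul mulVmx ?(cumR_unit Badm) // trmx1 mul1mx. Qed.

(** The [eps] of [localization] depends on the margin of [b0] and on the proportion 1/#B, which are
    the same at every occurrence of the pair. *)
Lemma equi_positive (M : 'M[int]_d) (B : seq 'cV[int]_d) b0 :
  b0 \in B -> contr M b0 @` cube t0 `<=` interior (cube t0) ->
  exists2 eps : R, 0 < eps &
  forall n (l : 'cV[int]_d), Rs n = M -> Bs n =i B ->
    exists k, forall len, eps <= tail_prod n len (intv (l + cumT n k)).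
Proof.
move=> b0B /affine_margin[r r0 rP].
case: (pselect (exists n, Rs n = M /\ Bs n =i B)) => [[n0 [_ Bn0]]|noex]; last first.
  by exists 1 => // n l nM nB; case: noex; exists n.
have c00 : 0 < (bsz n0)%:R^-1 :> R by rewrite invr_gt0 ltr0n (bsz_gt0 Badm).
have [eps eps0 [F FP]] := localization t0 r0 c00.
exists eps => // n l nM nB.
have bE : bsz n = bsz n0.
  have uniqB k : uniq (Bs k) by case: (Badm k).
  by apply/perm_size/uniq_perm => // b; rewrite nB Bn0.
pose xi := (invmx (cumR n))^T *m intv l.
(* The integral part of [xi] is itself an available shift; removing it leaves coordinates bounded by
   1. *)
pose k0 : 'cV[int]_d := \col_i Num.floor (xi i ord0).
have frac1 (x : vec) i : `|(x - intv (\col_i Num.floor (x i ord0))) i ord0| <= 1.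
  rewrite !mxE; have := floor_itv (x i ord0); rewrite intrD => /andP[h1 h2].
  by rewrite ger0_norm; lra.
have xi1 i : `|(xi - intv k0) i ord0| <= 1 by exact: frac1.
(* Atoms whose outermost contraction can be taken to be that of [b0]: at least a proportion 1/#B,
   all within the margin. *)
pose K : pred vec := fun z => `[< exists2 x, cube t0 x & z = contr M b0 x >].
have ex_len len : exists2 k, k \in F &
    eps <= tail_prod n len.+1 (intv (l + cumT n (k - k0))).
  have [||k kF kP] := FP (tail_pts n len.+1) K _ (size_tail_pts_gt0 _ _) xi1
     (@tail_pts_cube n len.+1).
  - move=> z i /asboolP[x xC ->]; exact: rP.
  - rewrite ler_pdivrMl ?ltr0n ?(bsz_gt0 Badm) // -natrM ler_nat -bE size_tail_ptsS.
    rewrite leq_mul2l -[count _ _]sum1_count big_mkcond /= big_allpairs_dep /=.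
    have b0n : b0 \in Bs n by rewrite nB.
    rewrite (big_rem b0) //= (leq_trans _ (leq_addr _ _)) ?orbT //.
    rewrite -sum1_size big_seq [leqRHS]big_seq leq_sum // => z zT.
    rewrite ifT //; apply/asboolP; exists z; last by rewrite nM.
    exact: tail_pts_cube zT.
  exists k => //; rewrite intvD intv_cumT [X in X + _](cumT_xi n) -mulmxDr tail_prodE.
  rewrite ler_pdivlMr ?exprn_gt0 ?ltr0n ?size_tail_pts_gt0 //.
  by rewrite intvB [intv k - _]addrC addrA.
(* One shift must serve all lengths. [F] is finite and tail products decrease with the length, so if
   every shift failed at some length, all of [F] would fail beyond the largest of these. *)
apply: contrapT => nok.
have bad k : exists len, tail_prod n len (intv (l + cumT n (k - k0))) < eps.
  apply: contrapT => nolen; apply: nok; exists (k - k0) => len.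
  by rewrite leNgt; apply/negP => h; apply: nolen; exists len.
pose lenk (k : 'cV[int]_d) : nat := xchoose (bad k).
have [k kF] := ex_len (\max_(k <- F) lenk k)%N.
apply/negP; rewrite -ltNge; apply: le_lt_trans (xchooseP (bad k)).
apply: tail_prod_mono; apply: leq_trans (leqnSn _).
exact: (@leq_bigmax_seq _ F xpredT lenk).
Qed.

Lemma mx_norm_coord m n (A : 'M[R]_(m, n)) i j : `|A i j| <= `|A|.
Proof.
rewrite [leRHS]mx_normrE; exact: (le_bigmax _ (fun ij => `|A ij.1 ij.2|) (i, j)).
Qed.

Lemma mulmx_coord_le (A : 'M[R]_d) (x : vec) i (a c : R) :
  (forall j, `|A i j| <= c) -> (forall j, `|x j ord0| <= a) ->
  `|(A *m x) i ord0| <= c * (d%:R * a).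
Proof.
move=> Ac xa; rewrite mxE; apply: le_trans (ler_norm_sum _ _ _) _.
have -> : c * (d%:R * a) = \sum_(j < d) (c * a).
  by rewrite big_const cardE size_enum_ord iter_addr_0 mulrCA mulr_natl.
by apply: ler_sum => j _; rewrite normrM ler_pM.
Qed.

Lemma cube_bounded : exists2 T : R, 0 <= T &
  forall x, cube t0 x -> forall i, `|x i ord0| <= T.
Proof.
exists (\sum_i `|t0 i ord0| + 1); first by rewrite addr_ge0 // sumr_ge0.
move=> x xC i; have := xC i => /andP[x1 x2].
have : `|t0 i ord0| <= \sum_j `|t0 j ord0|.
  by rewrite (bigD1 i) //= lerDl sumr_ge0.
by have := lexx `|t0 i ord0|; rewrite !ler_norml => /andP[? ?] ?; apply/andP; split; lra.
Qed.

Lemma invcum_small (e : R) : 0 < e ->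
  exists N, forall n, (N <= n)%N -> `|invmx (cumR n)| < e.
Proof.
move=> e0; have /cvgrPdist_lt/(_ e e0)[N _ NP] := Rcvg.
exists N.+1 => -[//|n]; rewrite ltnS => /NP /=.
by rewrite sub0r normrN normr_id.
Qed.

(** Rescaled to level [n], a fixed frequency tends to 0 while the tail atoms stay in the cube;
    eventually all cosines exceed 1/2, and 1/4 is the square. *)
Lemma tail_positive (Lam : seq 'cV[int]_d) : exists N, forall n, (N <= n)%N ->
  forall l, l \in Lam -> forall len, 4^-1 <= tail_prod n len (intv l).
Proof.
have [T T0 TP] := cube_bounded.
have pi0 : 0 < pi :> R := pi_gt0 R.
have [|delta delta0 cosd] := @cos_near1 R 2^-1; first by rewrite invr_gt0.
elim: Lam => [|l Lam [N NP]]; first by exists 0%N.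
pose a : R := \sum_i `|intv l i ord0|.
have a0 : 0 <= a by rewrite sumr_ge0.
pose Q := 2 * pi * (d%:R * (d%:R * a * T)).
have Q0 : 0 <= Q by rewrite !mulr_ge0 // ltW.
have [N' N'P] : exists N, forall n, (N <= n)%N -> `|invmx (cumR n)| < delta / (Q + 1).
  by apply: invcum_small; rewrite divr_gt0 // ltr_wpDl.
exists (maxn N N') => n; rewrite geq_max => /andP[Nn N'n] l'.
rewrite inE => /predU1P[->|/NP]; last exact.
move=> len; rewrite (cumT_xi n); set xi := _ *m intv l.
have xib i : `|xi i ord0| <= `|invmx (cumR n)| * (d%:R * a).
  apply: mulmx_coord_le => j; first by rewrite mxE mx_norm_coord.
  by rewrite /a (bigD1 j) //= lerDl sumr_ge0.
rewrite tail_prodE ler_pdivlMr ?exprn_gt0 ?ltr0n ?size_tail_pts_gt0 //.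
set Z := tail_pts n len.
apply: le_trans (_ : complex.Re (\sum_(z <- Z) expi (- xi) z) ^+ 2 <= _); last first.
  by rewrite lerDl sqr_ge0.
have -> : 4^-1 * (size Z)%:R ^+ 2 = (2^-1 * (size Z)%:R) ^+ 2 :> R.
  by rewrite exprMn; congr (_ * _); rewrite exprVn -natrX.
have le1 : 2^-1 * (size Z)%:R <= complex.Re (\sum_(z <- Z) expi (- xi) z).
  rewrite Re_sum mulr_natr -iter_addr_0 -(count_predT Z) -big_const_seq.
  rewrite big_seq [leRHS]big_seq; apply: ler_sum => z zZ; rewrite /expi /=.
  suff /cosd : `|2 * pi * dotR (- xi) z| < delta by lra.
  rewrite normrM gtr0_norm ?mulr_gt0 //.
  have db : `|dotR (- xi) z| <= d%:R * ((`|invmx (cumR n)| * (d%:R * a)) * T).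
    apply: le_trans (ler_norm_sum _ _ _) _.
    set u := _ * T; have -> : d%:R * u = \sum_(i < d) u.
      by rewrite big_const cardE size_enum_ord iter_addr_0 mulr_natl.
    apply: ler_sum => i _; rewrite normrM mxE normrN ler_pM //.
    by apply: TP; apply: tail_pts_cube zZ.
  apply: le_lt_trans (ler_wpM2l _ db) _; first by rewrite mulr_ge0 // ltW.
  have -> : 2 * pi * (d%:R * (`|invmx (cumR n)| * (d%:R * a) * T)) =
     `|invmx (cumR n)| * Q by rewrite /Q; ring.
  have := N'P n N'n; rewrite ltr_pdivlMr ?ltr_wpDl //.
  have := normr_ge0 (invmx (cumR n)); nra.
rewrite lerXn2r ?nnegrE //; last apply: le_trans le1.
by rewrite mulr_ge0 // invr_ge0.
Qed.

End EquiPositivity.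

(** * Parseval identities in the limit *)

Section DominatedParseval.
Variables (R : realType) (T : choiceType).

Lemma sum_sub_uniq (s1 s2 : seq T) (F : T -> R) : uniq s1 -> uniq s2 ->
  {subset s1 <= s2} ->
  \sum_(l <- s2) F l = \sum_(l <- s1) F l + \sum_(l <- s2 | l \notin s1) F l.
Proof.
move=> u1 u2 s12; rewrite (bigID (mem s1)) /=; congr (_ + _).
rewrite -big_filter; apply: perm_big; apply: uniq_perm => //.
  exact: filter_uniq.
by move=> l; rewrite mem_filter andb_idr // => /s12.
Qed.

Lemma cvg_seq_sum (s : seq T) (c : nat -> T -> R) (a : T -> R) :
  (forall l, c ^~ l @ \oo --> a l) ->
  (fun i => \sum_(l <- s) c i l) @ \oo --> \sum_(l <- s) a l.
Proof.
move=> ca; elim: s => [|l s IHs].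
  by rewrite big_nil; under eq_fun do rewrite big_nil; exact: cvg_cst.
by rewrite big_cons; under eq_fun do rewrite big_cons; exact: cvgD.
Qed.

(* If the partial sums of [a] stayed below [g - eta], the lower bound
   [eps * c <= a] would make them grow by a fixed amount infinitely often. *)
Lemma dominated_parseval (c : nat -> T -> R) (a : T -> R) (L : nat -> seq T)
    (g eps : R) (i0 : nat) :
  0 < eps -> (forall j, uniq (L j)) -> (forall j, {subset L j <= L j.+1}) ->
  (forall i l, 0 <= c i l) -> (forall l, c ^~ l @ \oo --> a l) ->
  (forall i, (i0 <= i)%N -> \sum_(l <- L i) c i l = g) ->
  (forall i, (i0 <= i)%N -> forall l, l \in L i -> eps * c i l <= a l) ->
  forall eta, 0 < eta -> exists j, g - eta <= \sum_(l <- L j) a l.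
Proof.
move=> eps0 uL sL c0 ca cg ac eta eta0; apply: contrapT => noj.
pose S j := \sum_(l <- L j) a l.
have Slt j : S j < g - eta.
  by rewrite ltNge; apply/negP => Sj; apply: noj; exists j.
have sub j i : (j <= i)%N -> {subset L j <= L i}.
  move=> /subnK <-; elim: (i - j)%N => [|e IHe] l // /IHe; exact: sL.
have a0 l : 0 <= a l.
  rewrite leNgt; apply/negP => al.
  have /cvgrPdist_lt/(_ (- a l)) := ca l; rewrite oppr_gt0.
  move=> /(_ al)[N _ /(_ N (leqnn _))] /=.
  by rewrite distrC => /(le_lt_trans (ler_norm _)); have := c0 N l; lra.
have S0 j : 0 <= S j by apply: sumr_ge0.
(* For large [i] the frequencies of [L j] carry less than [g - eta / 2], so those added up to [L i]
   carry at least [eta / 2], of which [a] retains the proportion [eps]. *)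
have grow j : exists i, S j + eps * (eta / 2) <= S i.
  have : (fun i => \sum_(l <- L j) c i l) @ \oo --> S j by exact: cvg_seq_sum.
  move=> /cvgrPdist_lt/(_ (eta / 2)); rewrite divr_gt0 // => /(_ isT)[N _ NP].
  pose i := maxn N (maxn i0 j).
  have iN : (N <= i)%N by rewrite leq_maxl.
  have ii0 : (i0 <= i)%N by rewrite !leq_max leqnn orbT.
  have ij : (j <= i)%N by rewrite !leq_max leqnn !orbT.
  exists i.
  have h1' : \sum_(l <- L j) c i l < S j + eta / 2.
    have := NP i iN => /=; rewrite distrC => /(le_lt_trans (ler_norm _)); lra.
  have sL' := sub _ _ ij; have g1 := cg i ii0.
  rewrite (sum_sub_uniq _ (uL j) (uL i) sL') in g1.
  rewrite /S (sum_sub_uniq _ (uL j) (uL i) sL') lerD2l.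
  have : eps * \sum_(l <- L i | l \notin L j) c i l <=
      \sum_(l <- L i | l \notin L j) a l.
    rewrite mulr_sumr big_seq_cond [leRHS]big_seq_cond.
    by apply: ler_sum => l /andP[li _]; apply: ac.
  apply: le_trans; rewrite ler_pM2l //; have := Slt j; lra.
have unb k : exists j, k%:R * (eps * (eta / 2)) <= S j.
  elim: k => [|k [j jP]]; first by exists 0%N; rewrite mul0r.
  by have [i iP] := grow j; exists i; rewrite -natr1 mulrDl mul1r; lra.
have e0 : 0 < eps * (eta / 2) by rewrite mulr_gt0 // divr_gt0.
have [j] := unb (Num.truncn ((g - eta) / (eps * (eta / 2)))).+1.
apply/negP; rewrite -ltNge; apply: lt_trans (Slt j) _.
by rewrite -ltr_pdivrMr // truncnS_gt.
Qed.

End DominatedParseval.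

(** * Construction of the nested spectra *)

Section SpectrumConstruction.
Variables (R : realType) (d : nat).
Variables (Rs : nat -> 'M[int]_d) (Bs : nat -> seq 'cV[int]_d) (t0 : vecR R d).
Hypothesis Badm : forall n, admissible R (Rs n) (Bs n).
Hypothesis Rcvg : (fun n => `| invmx (cumR R Rs n.+1) |) @ \oo --> (0 : R).
Hypothesis Ccontr :
  forall n b, b \in Bs n -> contr (Rs n) b @` cube t0 `<=` cube t0.

Local Notation vec := (vecR R d).
Local Notation intv := (@intv R d).
Local Notation Spec := (Spec R Rs Bs).
Local Notation cumT := (cumT Rs).
Local Notation tail_prod := (tail_prod Rs Bs).
Local Notation coefa := (coefa Rs Bs).

(** Only the new frequencies are shifted, by the hypothesis; the old ones stay fixed and are handled
    by [tail_positive], which asks for [m] large. *)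
Lemma Spec_next (eps : R) n Lam :
  (forall N, exists2 m, (N <= m)%N & forall l, exists k, forall len,
     eps <= tail_prod m len (intv (l + cumT m k))) ->
  Spec n Lam ->
  exists m Lam', [/\ (n < m)%N, Spec m Lam', {subset Lam <= Lam'} &
    forall l, l \in Lam' -> forall len,
      Order.min eps 4^-1 <= tail_prod m len (intv l)].
Proof.
move=> H sL; have [N NP] := tail_positive Badm Rcvg Ccontr Lam.
have [m] := H (maxn N n.+1); rewrite geq_max => /andP[Nm nm] mP.
have [Lam1 sL1 sub1] := Spec_extend Badm (ltnW nm) sL.
have [kf kfP] : {kf : 'cV[int]_d -> 'cV[int]_d & forall l,
    (l \in Lam -> kf l = 0) /\ (l \notin Lam -> forall len,
      eps <= tail_prod m len (intv (l + cumT m (kf l))))}.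
  apply: (@choice _ _ (fun l k => (l \in Lam -> k = 0) /\
    (l \notin Lam -> forall len, eps <= tail_prod m len (intv (l + cumT m k))))) => l.
  case: (boolP (l \in Lam)) => lL; first by exists 0.
  by have [k kP] := mP l; exists k.
have kf0 l : l \in Lam -> l + cumT m (kf l) = l.
  by move=> /(proj1 (kfP l)) ->; rewrite cumT0 addr0.
exists m, [seq l + cumT m (kf l) | l <- Lam1]; split => //.
- exact: Spec_shift.
- by move=> l lL; apply/mapP; exists l; [exact: sub1|rewrite kf0].
- move=> _ /mapP[l lL ->] len; case: (boolP (l \in Lam)) => lL'.
    by rewrite kf0 // (le_trans _ (NP m Nm l lL' len)) // ge_min lexx orbT.
  by rewrite (le_trans _ (proj2 (kfP l) lL' len)) // ge_min lexx.
Qed.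

(** Positivity is stated from index 1 on, since the initial spectrum [[:: 0]] of level 0 does not
    come from [Spec_next]. *)
Lemma spectrum_tower (M : 'M[int]_d) (B : seq 'cV[int]_d) b0 :
  (forall N, exists2 n, (N <= n)%N & Rs n = M /\ Bs n =i B) ->
  b0 \in B -> contr M b0 @` cube t0 `<=` interior (cube t0) ->
  exists (eps : R) (nn : nat -> nat) (L : nat -> seq 'cV[int]_d),
  [/\ 0 < eps, forall j, (nn j < nn j.+1)%N, forall j, Spec (nn j) (L j),
      forall j, {subset L j <= L j.+1} &
      forall j l, l \in L j.+1 -> forall len,
        eps <= tail_prod (nn j.+1) len (intv l)].
Proof.
move=> often b0B b0int.
have [eps eps0 EP] := equi_positive Badm Ccontr b0B b0int.
have H N : exists2 m, (N <= m)%N & forall l, exists k, forall len,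
    eps <= tail_prod m len (intv (l + cumT m k)).
  by have [m Nm [mM mB]] := often N; exists m => // l; apply: EP.
pose St := {p : nat * seq 'cV[int]_d | Spec p.1 p.2}.
pose good (p q : St) := [/\ ((sval p).1 < (sval q).1)%N,
  {subset (sval p).2 <= (sval q).2} & forall l, l \in (sval q).2 -> forall len,
      Order.min eps 4^-1 <= tail_prod (sval q).1 len (intv l)].
have [next nextP] : {next : St -> St & forall p, good p (next p)}.
  apply: (@choice _ _ good) => -[[n Lam] /= sL].
  have [m [Lam' [nm sL' sub' pos]]] := Spec_next H sL.
  by exists (exist (fun p => Spec p.1 p.2) (m, Lam') sL').
pose p0 : St := exist (fun p => Spec p.1 p.2) (0%N, [:: 0]) (Spec0 R Rs Bs).
pose st j := iter j next p0.
exists (Order.min eps 4^-1), (fun j => (sval (st j)).1), (fun j => (sval (st j)).2).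
split.
- by rewrite lt_min eps0 invr_gt0 ltr0n.
- by move=> j; case: (nextP (st j)).
- by move=> j; exact: (svalP (st j)).
- by move=> j; case: (nextP (st j)).
- by move=> j; case: (nextP (st j)).
Qed.

Lemma cvg_subseq_nat (nn : nat -> nat) (f : nat -> R) (a : R) :
  (forall j, (nn j < nn j.+1)%N) -> f @ \oo --> a -> (f \o nn) @ \oo --> a.
Proof.
move=> nnS fa; have nnge j : (j <= nn j)%N.
  by elim: j => // j IHj; exact: leq_ltn_trans IHj (nnS j).
apply: cvg_comp fa; apply/cvgnyPge => A; exists A => // j /= Aj.
exact: leq_trans (nnge j).
Qed.

(** A later squared coefficient is the one of level [nn i] times a tail product, hence at least
    [eps] times it; this survives in the limit and is the domination required. *)
Lemma parseval_limit eps nn L m (G : nat -> R) (al : 'cV[int]_d -> R[i]) :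
  0 < eps -> (forall j, (nn j < nn j.+1)%N) -> (forall j, Spec (nn j) (L j)) ->
  (forall j, {subset L j <= L j.+1}) ->
  (forall j l, l \in L j.+1 -> forall len,
     eps <= tail_prod (nn j.+1) len (intv l)) ->
  (forall l, (fun N => nrm2 (coefa m G (intv l) N)) @ \oo --> nrm2 (al l)) ->
  forall eta, 0 < eta -> exists j,
    avg Bs m (fun j => G j ^+ 2) - eta <= \sum_(l <- L j) nrm2 (al l).
Proof.
move=> eps0 nnS sL subL pos cv.
have nnge j : (j <= nn j)%N.
  by elim: j => // j IHj; exact: leq_ltn_trans IHj (nnS j).
(* From [m.+1] on, the level is at least [m] and the index is a successor, as the lower bound
   demands. *)
apply: (@dominated_parseval R _ (fun i l => nrm2 (coefa m G (intv l) (nn i)))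
  _ L _ eps m.+1) => //.
- by move=> j; case: (sL j).
- by move=> i l; exact: nrm2_ge0.
- move=> l; exact: (cvg_subseq_nat nnS (cv l)).
- move=> i mi; apply: parseval => //; exact: leq_trans (ltnW mi) (nnge i).
- case=> // i; rewrite ltnS => mi l lL.
  have mn : (m <= nn i.+1)%N by apply: leq_trans (nnge _); exact: leqW.
  rewrite leNgt; apply/negP => lt.
  have := cv l => /cvgrPdist_lt.
  move=> /(_ (eps * nrm2 (coefa m G (intv l) (nn i.+1)) - nrm2 (al l))).
  rewrite subr_gt0 => /(_ lt)[N _ /(_ (nn i.+1 + N)%N (leq_addl _ _))] /=.
  rewrite coefa_nrm2 // distrC => /(le_lt_trans (ler_norm _)).
  have h : eps <= \prod_(nn i.+1 <= k < nn i.+1 + N) nrm2 (Dk Rs Bs k (intv l)).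
    exact: pos.
  have := ler_wpM2l (nrm2_ge0 (coefa m G (intv l) (nn i.+1))) h.
  by lra.
Qed.

End SpectrumConstruction.

(** * Continuity and Borel measurability *)

Section ContinuityMeasurability.
Variables (R : realType) (d : nat).
Local Notation vec := (vecR R d).

Lemma continuous_bigsum (T : topologicalType) (I : Type) (r : seq I)
    (F : I -> T -> R) :
  (forall i, continuous (F i)) -> continuous (fun x => \sum_(i <- r) F i x).
Proof.
move=> cF x; elim: r => [|i r IHr].
  by under eq_fun do rewrite big_nil; exact: cvg_cst.
under eq_fun do rewrite big_cons.
by apply: cvgD => //; exact: cF.
Qed.

Lemma continuous_addr (T : topologicalType) (f g : T -> R) :
  continuous f -> continuous g -> continuous (fun x => f x + g x).
Proof. by move=> cf cg x; apply: cvgD; [exact: cf|exact: cg]. Qed.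

Lemma continuous_subr (T : topologicalType) (f g : T -> R) :
  continuous f -> continuous g -> continuous (fun x => f x - g x).
Proof. by move=> cf cg x; apply: cvgB; [exact: cf|exact: cg]. Qed.

Lemma continuous_mulr (T : topologicalType) (f g : T -> R) :
  continuous f -> continuous g -> continuous (fun x => f x * g x).
Proof. by move=> cf cg x; apply: cvgM; [exact: cf|exact: cg]. Qed.

Lemma continuous_scaler (T : topologicalType) (c : R) (f : T -> R) :
  continuous f -> continuous (fun x => c * f x).
Proof. by move=> cf x; apply: cvgM; [exact: cvg_cst|exact: cf]. Qed.

Lemma continuous_dotR (l : vec) : continuous (fun x : vec => dotR l x).
Proof.
apply: continuous_bigsum => i; apply: continuous_scaler.
exact: coord_continuous.
Qed.

Lemma continuous_cosdot (l : vec) :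
  continuous (fun x : vec => cos (2 * pi * dotR l x)).
Proof.
move=> x; apply: (@continuous_comp _ _ _ (fun x : vec => 2 * pi * dotR l x) cos).
  exact: (continuous_scaler (@continuous_dotR l)).
exact: continuous_cos.
Qed.

Lemma continuous_sindot (l : vec) :
  continuous (fun x : vec => sin (2 * pi * dotR l x)).
Proof.
move=> x; apply: (@continuous_comp _ _ _ (fun x : vec => 2 * pi * dotR l x) sin).
  exact: (continuous_scaler (@continuous_dotR l)).
exact: continuous_sin.
Qed.

Lemma borel_open (U : set vec) : open U -> measurable (U : set (borelRd R d)).
Proof. by move=> oU; apply: sub_sigma_algebra. Qed.

Lemma continuous_borel_measurable (f : vec -> R) :
  continuous f -> measurable_fun setT (f : borelRd R d -> R).
Proof.
move=> /continuousP cf; apply: (measurability _ (RGenOpens.measurableE R)).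
move=> _ [_ [a [b ->] <-]]; rewrite setTI; apply: borel_open.
exact/cf/interval_open.
Qed.

End ContinuityMeasurability.

Lemma norm_cos_le1 (R : realType) (t : R) : `|cos t| <= 1.
Proof. by rewrite ler_norml cos_geN1 cos_le1. Qed.

Lemma norm_sin_le1 (R : realType) (t : R) : `|sin t| <= 1.
Proof. by rewrite ler_norml sin_geN1 sin_le1. Qed.

(** * Integrability on a probability space *)

Section BoundedIntegrable.
Variables (R : realType) (dO : measure_display) (Om : measurableType dO).
Variable P : probability Om R.

Lemma bounded_of (C : R) (f : Om -> R) :
  (forall w, `|f w| <= C) -> [bounded f w | w in setT].
Proof.
move=> fC; exists C; split; first exact: num_real.
by move=> M CM w _ /=; rewrite (le_trans (fC w)) // ltW.
Qed.

Lemma bounded_integrable (C : R) (f : Om -> R) : measurable_fun setT f ->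
  (forall w, `|f w| <= C) -> P.-integrable setT (EFin \o f).
Proof.
move=> mf fC; apply: measurable_bounded_integrable => //.
  by rewrite (le_lt_trans (probability_le1 P measurableT)) // ltry.
exact: bounded_of fC.
Qed.

Lemma integrableM_bounded (C : R) (h f : Om -> R) :
  P.-integrable setT (EFin \o h) -> measurable_fun setT f ->
  (forall w, `|f w| <= C) -> P.-integrable setT (EFin \o (h \* f)).
Proof.
move=> ih mf fC.
have := integrableMl measurableT ih mf (bounded_of fC).
by apply: eq_integrable.
Qed.

Lemma integrable_of_sqr (h : Om -> R) : measurable_fun setT h ->
  P.-integrable setT (fun w => (h w ^+ 2)%:E) -> P.-integrable setT (EFin \o h).
Proof.
move=> mh ih.
have i1 : P.-integrable setT (EFin \o (fun w => 1 + h w ^+ 2)).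
  have := integrableD measurableT (finite_measure_integrable_cst P 1 measurableT) ih.
  by apply: eq_integrable.
apply: le_integrable i1 => //; first exact/measurable_EFinP.
move=> w _ /=; rewrite lee_fin.
rewrite [leRHS]ger0_norm; last by rewrite addr_ge0 // sqr_ge0.
rewrite ler_norml; apply/andP; split; have := sqr_ge0 (h w); nra.
Qed.

End BoundedIntegrable.

(** * The limit variable on an abstract space of digits *)

Section DigitSpace.
Variables (R : realType) (d : nat).
Variables (Rs : nat -> 'M[int]_d) (Bs : nat -> seq 'cV[int]_d) (t0 : vecR R d).
Hypothesis Badm : forall n, admissible R (Rs n) (Bs n).
Hypothesis Rcvg : (fun n => `| invmx (cumR R Rs n.+1) |) @ \oo --> (0 : R).
Hypothesis Ccontr :
  forall n b, b \in Bs n -> contr (Rs n) b @` cube t0 `<=` cube t0.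

Variables (dO : measure_display) (Om : measurableType dO).
Variables (P : probability Om R) (J : nat -> Om -> nat).
Hypothesis Jlt : forall n w, (J n w < Nn Bs n)%N.
Hypothesis JS : forall n w, J n w = (J n.+1 w %/ bsz Bs n)%N.
Hypothesis Jmeas : forall n (A : set nat), measurable (J n @^-1` A).
Hypothesis Jprob : forall n j, (j < Nn Bs n)%N ->
  P (J n @^-1` [set j]) = ((Nn Bs n)%:R^-1)%:E.

Local Notation vec := (vecR R d).
Local Notation intv := (@intv R d).
Local Notation cumR := (cumR R Rs).
Local Notation Nn := (Nn Bs).
Local Notation bsz := (bsz Bs).
Local Notation xpt := (xpt R Rs Bs).
Local Notation anc := (anc Bs).
Local Notation avg := (avg Bs).
Local Notation Spec := (Spec R Rs Bs).
Local Notation coefa := (coefa Rs Bs).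
Local Notation tail_prod := (tail_prod Rs Bs).

Lemma J_anc m N w : (m <= N)%N -> anc m N (J N w) = J m w.
Proof.
move=> /subnK <-; elim: (N - m)%N => [|e IHe]; first by rewrite anc_id.
by rewrite addSn anc_step ?leq_addl // -JS.
Qed.

Lemma measurable_J n (phi : nat -> R) : measurable_fun setT (fun w => phi (J n w)).
Proof. by move=> _ Y mY; rewrite setTI; exact: (Jmeas n (phi @^-1` Y)). Qed.

(** [J n] is uniform on the indices of level [n], so the law of [Xn n] is the finite convolution of
    that level. *)
Lemma integral_J n (phi : nat -> R) :
  (\int[P]_w (phi (J n w))%:E)%E = (avg n phi)%:E.
Proof.
have phiE w : (phi (J n w))%:E =
    \sum_(0 <= j < Nn n) ((phi j)%:E * (\1_(J n @^-1` [set j]) w)%:E)%E.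
  rewrite (bigD1_seq (J n w)) ?mem_index_iota ?iota_uniq ?Jlt //=.
  rewrite big1 => [|j jJ]; rewrite indicE; last first.
    rewrite memNset ?mule0 // => /= Jj; move: jJ; rewrite Jj eqxx.
    by [].
  by rewrite mem_set // mule1 adde0.
under eq_integral do rewrite phiE.
rewrite integral_sum //; last first.
  move=> j; apply: integrableZl => //; apply: integrable_indic => //.
rewrite /avg mulr_sumr -sumEFin; apply: eq_big_nat => j /andP[_ jN].
rewrite integralZl //; last by apply: integrable_indic.
have -> : (\int[P]_w (\1_(J n @^-1` [set j]) w)%:E)%E = P (J n @^-1` [set j]).
  by rewrite integral_indic // setIT.
by rewrite Jprob // -EFinM mulrC.
Qed.

Definition Xn n w : vec := xpt n (J n w).

(** Adding the digit [b] to [c] and applying the inverse of [cumR n.+1] is applying that of [cumR n]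
    to the contraction of [c], which stays in the cube by (ii). *)
Lemma cell_step n j c : cube t0 c -> exists2 c', cube t0 c' &
  xpt n.+1 j + invmx (cumR n.+1) *m c = xpt n (j %/ bsz n) + invmx (cumR n) *m c'.
Proof.
move=> cC; set b := nth 0 (Bs n) (j %% bsz n)%N.
have bB : b \in Bs n by rewrite mem_nth // ltn_mod (bsz_gt0 Badm).
exists (contr (Rs n) b c); first by apply: (Ccontr bB); exists c.
rewrite /= -/b -addrA -mulmxDr; congr (_ + _).
rewrite /contr mulmxA [intv b + c]addrC; congr (_ *m _).
have u := cumR_unit Badm n.+1.
apply: (can_inj (mulKmx u)); rewrite [LHS]mulmxV // [cumR n.+1]/= -mulmxA.
by rewrite mulKVmx ?(cumR_unit Badm) // mulmxV // (Rs_unit Badm).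
Qed.

Lemma cell_nest n e w c : cube t0 c -> exists2 c', cube t0 c' &
  Xn (n + e) w + invmx (cumR (n + e)) *m c = Xn n w + invmx (cumR n) *m c'.
Proof.
elim: e c => [|e IHe] c cC; first by rewrite addn0; exists c.
rewrite addnS; have [c1 c1C c1E] := cell_step (n + e) (J (n + e).+1 w) cC.
have [c2 c2C c2E] := IHe c1 c1C; exists c2 => //.
by rewrite -c2E /Xn [J (n + e) w]JS; exact: c1E.
Qed.

(** The point with offset [t0] in the deeper cell also lies in the cell of level [n]; the two atoms
    differ by two offsets, each bounded at its own level. *)
Lemma Xn_cauchy : exists2 dn : nat -> R, dn @ \oo --> (0 : R) &
  forall n N w i, (n <= N)%N ->
    `|Xn N w i ord0 - Xn n w i ord0| <= dn N + dn n.
Proof.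
have [T T0 TP] := cube_bounded t0.
exists (fun n => `|invmx (cumR n)| * (d%:R * T)).
  have -> : 0 = 0 * (d%:R * T) :> R by rewrite mul0r.
  apply: cvgM; last exact: cvg_cst.
  apply/cvgrPdist_lt => e e0; have [N NP] := invcum_small Rcvg e0.
  by exists N => // k /= /NP; rewrite sub0r normrN normr_id.
move=> n N w i /subnKC <-; set e := (N - n)%N.
have [c cC cE] := cell_nest n e w (cube_t0 t0).
have -> : Xn (n + e) w i ord0 - Xn n w i ord0 =
    (invmx (cumR n) *m c) i ord0 - (invmx (cumR (n + e)) *m t0) i ord0.
  have := congr1 (fun v : vec => v i ord0) cE; rewrite /= mxE [RHS]mxE => h.
  by lra.
apply: le_trans (ler_normB _ _) _; rewrite addrC; apply: lerD.
  apply: mulmx_coord_le => j; first exact: mx_norm_coord.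
  by apply: TP; exact: cube_t0.
by apply: mulmx_coord_le => j; [exact: mx_norm_coord|exact: TP].
Qed.

Definition X w : vec := \col_i lim ((fun n => Xn n w i ord0) @ \oo).

Lemma Xn_rate : exists2 dn : nat -> R, dn @ \oo --> (0 : R) &
  forall n w i, `|X w i ord0 - Xn n w i ord0| <= dn n.
Proof.
have [dn dn0 dnP] := Xn_cauchy; exists dn => // n w i.
have dsmall e : 0 < e -> exists N, forall k, (N <= k)%N -> dn k < e.
  move=> e0; have /cvgrPdist_lt/(_ e e0)[N _ NP] := dn0.
  by exists N => k /NP /=; rewrite sub0r normrN => /(le_lt_trans (ler_norm _)).
have cv : cvg ((fun n => Xn n w i ord0) @ \oo).
  apply/cauchy_cvgP/cauchy_exP => e e0.
  have [|N NP] := dsmall (e / 2); first by rewrite divr_gt0.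
  exists (Xn N w i ord0); exists N => // k /= Nk.
  rewrite /ball /= distrC (le_lt_trans (dnP N k w i Nk)) //.
  by have := NP k Nk; have := NP N (leqnn _); lra.
rewrite mxE; apply/ler_addgt0Pr => e e0.
move/cvgrPdist_lt : (cv) => /(_ (e / 2)); rewrite divr_gt0 // => /(_ isT)[N1 _ N1P].
have [|N2 N2P] := dsmall (e / 2); first by rewrite divr_gt0.
pose k := maxn n (maxn N1 N2).
have kn : (n <= k)%N by rewrite leq_maxl.
have k1 : (N1 <= k)%N by rewrite !leq_max leqnn !orbT.
have k2 : (N2 <= k)%N by rewrite !leq_max leqnn !orbT.
have h1 := N1P k k1; have h2 := N2P k k2; have h3 := dnP n k w i kn.
rewrite /= in h1.
have := ler_normD (lim ((fun n => Xn n w i ord0) @ \oo) - Xn k w i ord0)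
  (Xn k w i ord0 - Xn n w i ord0).
by rewrite addrA subrK => /le_trans; apply; lra.
Qed.

Lemma cvg_Xn w : (fun n => Xn n w) @ \oo --> X w.
Proof.
have [dn dn0 dnP] := Xn_rate; apply/cvg_ballP => e e0.
have /cvgrPdist_lt/(_ e e0)[N _ NP] := dn0; exists N => // k /= Nk.
split => // i j; rewrite ord1 /ball /= (le_lt_trans (dnP k w i)) //.
by have := NP k Nk; rewrite /= sub0r normrN => /(le_lt_trans (ler_norm _)).
Qed.

Lemma open_coord (U : set vec) x : open U -> U x ->
  exists2 r : R, 0 < r & forall y : vec, (forall i, `|x i ord0 - y i ord0| < r) -> U y.
Proof.
move=> oU Ux; have /nbhs_ballP[r /= r0 rP] : nbhs x U by exact: open_nbhs_nbhs.
by exists r => // y xy; apply: rP; split => // i j; rewrite ord1; exact: xy.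
Qed.

(** [A n] collects the indices whose box of radius [dn n] around the atom lies in [U]. As [X] stays
    in that box, this approximates [U] from inside. *)
Lemma open_cylinders (U : set vec) : open U ->
  exists A : nat -> set nat,
    (forall n w, A n (J n w) -> U (X w)) /\
    (forall w, U (X w) -> exists N, forall n, (N <= n)%N -> A n (J n w)).
Proof.
move=> oU; have [dn dn0 dnP] := Xn_rate.
exists (fun n k => forall y : vec,
  (forall i, `|y i ord0 - xpt n k i ord0| <= dn n) -> U y).
split; first by move=> n w; apply => i; exact: dnP.
move=> w /(open_coord oU)[r r0 rP].
have /cvgrPdist_lt/(_ (r / 2)) := dn0; rewrite divr_gt0 // => /(_ isT)[N _ NP].
exists N => n /NP /=; rewrite sub0r normrN => /(le_lt_trans (ler_norm _)) h y yP.
apply: rP => i; have h1 := dnP n w i; have h2 := yP i.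
have := ler_normB (X w i ord0 - Xn n w i ord0) (y i ord0 - xpt n (J n w) i ord0).
rewrite /Xn opprB addrA subrK => /le_lt_trans; apply; rewrite /Xn in h1; lra.
Qed.

Lemma measurable_X : measurable_fun setT (X : Om -> borelRd R d).
Proof.
apply: (@measurability _ _ Om (borelRd R d) setT X (@open vec) erefl).
move=> _ [U oU <-]; rewrite setTI.
have [A [A1 A2]] := open_cylinders oU.
rewrite (_ : _ @^-1` _ = \bigcup_n (J n @^-1` (A n))).
  by apply: bigcupT_measurable => n; exact: Jmeas.
apply/seteqP; split => w /=; last by move=> [n _ /=]; exact: A1.
by move=> /A2[N NP]; exists N => //; exact: NP.
Qed.

Section CylinderLimits.
Variables (m : nat) (f : nat -> vec -> R) (C : R).
Hypothesis cf : forall k, continuous (f k).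
Hypothesis fC : forall k x, `|f k x| <= C.

(** Written through [J N] alone, so that [integral_J] gives a finite average; for [m <= N] the cell
    index is [J m w]. *)
Let fn N w := f (anc m N (J N w)) (Xn N w).

Let fn_cvg w : (fun N => (fn N w)%:E) @ \oo --> (f (J m w) (X w))%:E.
Proof.
apply: cvg_EFin; first exact: nearW.
apply: (@cvg_trans _ ((fun N => f (J m w) (Xn N w)) @ \oo)).
  apply: near_eq_cvg; exists m => // N /= mN.
  by rewrite /fn /= J_anc.
apply: (@continuous_cvg _ _ _ _ _ (Xn ^~ w) (f (J m w)) (X w)); first exact: cf.
exact: cvg_Xn.
Qed.

Let fn_meas N : measurable_fun setT (fun w => (fn N w)%:E).
Proof.
apply/measurable_EFinP.
exact: (measurable_J N (fun k => f (anc m N k) (xpt N k))).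
Qed.

Let cst_int : P.-integrable setT (EFin \o cst C).
Proof. exact: finite_measure_integrable_cst. Qed.

Let fn_bound N w : setT w -> (`|(fn N w)%:E| <= (EFin \o cst C) w)%E.
Proof. by move=> _; rewrite /= lee_fin; exact: fC. Qed.

Lemma measurable_JX : measurable_fun setT (fun w => f (J m w) (X w)).
Proof.
apply/measurable_EFinP; apply: (emeasurable_fun_cvg (fun N w => (fn N w)%:E)) => //.
Qed.

Lemma integrable_JX : P.-integrable setT (EFin \o (fun w => f (J m w) (X w))).
Proof. exact: (bounded_integrable P measurable_JX (C := C)). Qed.

Lemma cvg_avg_ereal :
  (fun N => (avg N (fun j => f (anc m N j) (xpt N j)))%:E) @ \oo -->
  (\int[P]_w (f (J m w) (X w))%:E)%E.
Proof.
under eq_fun do rewrite -integral_J.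
apply: (@dominated_cvg _ _ _ P setT measurableT (fun N w => (fn N w)%:E)
  _ (EFin \o cst C)) => //.
Qed.

Lemma cvg_avg : (fun N => avg N (fun j => f (anc m N j) (xpt N j))) @ \oo -->
  \int[P]_w f (J m w) (X w).
Proof.
have := cvg_avg_ereal; rewrite -[X in _ --> X]fineK; last first.
  exact: integrable_fin_num integrable_JX.
exact: fine_cvg.
Qed.

End CylinderLimits.
End DigitSpace.

(** * Real integrals and weighted Young inequalities *)

Section RealIntegrals.
Variables (R : realType) (dO : measure_display) (Om : measurableType dO).
Variable P : probability Om R.
Local Notation intg f := (P.-integrable setT (EFin \o f)).

Lemma intg_D (f g : Om -> R) : intg f -> intg g -> intg (fun w => f w + g w).
Proof. by move=> fi gi; have := integrableD measurableT fi gi; apply: eq_integrable. Qed.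

Lemma intg_B (f g : Om -> R) : intg f -> intg g -> intg (fun w => f w - g w).
Proof. by move=> fi gi; have := integrableB measurableT fi gi; apply: eq_integrable. Qed.

Lemma intg_Z (r : R) (f : Om -> R) : intg f -> intg (fun w => r * f w).
Proof. by move=> fi; have := integrableZl measurableT r fi; apply: eq_integrable. Qed.

Lemma intg_sum0 (I : eqType) (r : seq I) (K : I -> Om -> R) :
  (forall i, i \in r -> intg (K i) /\ \int[P]_w K i w = 0) ->
  intg (fun w => \sum_(i <- r) K i w) /\ \int[P]_w (\sum_(i <- r) K i w) = 0.
Proof.
elim: r => [|i r IHr] KP.
  split.
    apply: (@bounded_integrable _ _ _ P 0) => [|w]; last by rewrite big_nil normr0.
    by under eq_fun do rewrite big_nil; exact: measurable_cst.
  under eq_Rintegral do rewrite big_nil.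
  by rewrite /Rintegral integral0.
have [|Ir Zr] := IHr; first by move=> k kr; apply: KP; rewrite inE kr orbT.
have [Ii Zi] := KP i (mem_head _ _).
have E w : \sum_(k <- i :: r) K k w = K i w + \sum_(k <- r) K k w by rewrite big_cons.
split; first by under eq_fun do rewrite E; exact: intg_D.
by under eq_Rintegral do rewrite E; rewrite RintegralD // Zi Zr addr0.
Qed.

Lemma Rintegral_EFin (f : Om -> R) : intg f ->
  (\int[P]_w (f w)%:E)%E = (\int[P]_w f w)%:E.
Proof. by move=> fi; rewrite /Rintegral fineK //; exact: integrable_fin_num. Qed.

End RealIntegrals.

Lemma amgm (R : realType) (tau x y : R) : 0 < tau ->
  x * y <= 2^-1 * (tau * x ^+ 2 + tau^-1 * y ^+ 2).
Proof.
move=> t0; have : 0 <= tau^-1 * (tau * x - y) ^+ 2.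
  by rewrite mulr_ge0 ?sqr_ge0 // invr_ge0 ltW.
have -> : tau^-1 * (tau * x - y) ^+ 2 = tau * x ^+ 2 - 2 * (x * y) + tau^-1 * y ^+ 2.
  by field; rewrite gt_eqF.
by lra.
Qed.

(** Replaces Cauchy-Schwarz: after integration, [tau] balances a bounded norm against a small
    residual. *)
Lemma amgm2 (R : realType) (tau a b p r : R) : 0 < tau ->
  `|a * p - b * r| <= tau * (a ^+ 2 + b ^+ 2) + tau^-1 * (p ^+ 2 + r ^+ 2).
Proof.
move=> tau0.
have a1 := amgm a p tau0; have a2 := amgm b r tau0.
have a3 := amgm a (- p) tau0; have a4 := amgm b (- r) tau0.
rewrite !sqrrN !mulrN in a3 a4.
have s1 : 0 <= tau * a ^+ 2 by rewrite mulr_ge0 ?(ltW tau0) // sqr_ge0.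
have s2 : 0 <= tau * b ^+ 2 by rewrite mulr_ge0 ?(ltW tau0) // sqr_ge0.
have s3 : 0 <= tau^-1 * p ^+ 2 by rewrite mulr_ge0 ?invr_ge0 ?(ltW tau0) // sqr_ge0.
have s4 : 0 <= tau^-1 * r ^+ 2 by rewrite mulr_ge0 ?invr_ge0 ?(ltW tau0) // sqr_ge0.
by rewrite ler_norml !mulrDr; apply/andP; split; lra.
Qed.

(** * Completeness of the exponentials *)

Section Completeness.
Variables (R : realType) (d : nat).
Variables (Rs : nat -> 'M[int]_d) (Bs : nat -> seq 'cV[int]_d) (t0 : vecR R d).
Hypothesis Badm : forall n, admissible R (Rs n) (Bs n).
Hypothesis Rcvg : (fun n => `| invmx (cumR R Rs n.+1) |) @ \oo --> (0 : R).
Hypothesis Ccontr :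
  forall n b, b \in Bs n -> contr (Rs n) b @` cube t0 `<=` cube t0.

Variables (dO : measure_display) (Om : measurableType dO).
Variables (P : probability Om R) (J : nat -> Om -> nat).
Hypothesis Jlt : forall n w, (J n w < Nn Bs n)%N.
Hypothesis JS : forall n w, J n w = (J n.+1 w %/ bsz Bs n)%N.
Hypothesis Jmeas : forall n (A : set nat), measurable (J n @^-1` A).
Hypothesis Jprob : forall n j, (j < Nn Bs n)%N ->
  P (J n @^-1` [set j]) = ((Nn Bs n)%:R^-1)%:E.

Local Notation vec := (vecR R d).
Local Notation intv := (@intv R d).
Local Notation Nn := (Nn Bs).
Local Notation xpt := (xpt R Rs Bs).
Local Notation anc := (anc Bs).
Local Notation avg := (avg Bs).
Local Notation Spec := (Spec R Rs Bs).
Local Notation coefa := (coefa Rs Bs).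
Local Notation tail_prod := (tail_prod Rs Bs).
Local Notation X := (X R Rs Bs J).
Local Notation intg f := (P.-integrable setT (EFin \o f)).

Section Cylinder.
Variables (m : nat) (g : nat -> R).
Hypothesis g1 : forall k, `|g k| <= 1.

(** Fourier coefficient of [g (J m w)] against the exponential of [X w], taken under [P]; the
    conjugation sits in [- intv l]. *)
Definition bessel (l : 'cV[int]_d) : R[i] := Complex
  (\int[P]_w (g (J m w) * cos (2 * pi * dotR (- intv l) (X w))))
  (\int[P]_w (g (J m w) * sin (2 * pi * dotR (- intv l) (X w)))).

Lemma cvg_Re_coefa l :
  (fun N => complex.Re (coefa m g (intv l) N)) @ \oo --> complex.Re (bessel l).
Proof.
under eq_fun do rewrite Re_coefa.
apply: (cvg_avg Badm Rcvg Ccontr Jlt JS Jmeas Jprob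
  (f := fun k x => g k * cos (2 * pi * dotR (- intv l) x)) (C := 1)).
- by move=> k; apply: continuous_scaler; exact: continuous_cosdot.
- by move=> k x; rewrite normrM mulr_ile1 // norm_cos_le1.
Qed.

Lemma cvg_Im_coefa l :
  (fun N => complex.Im (coefa m g (intv l) N)) @ \oo --> complex.Im (bessel l).
Proof.
under eq_fun do rewrite Im_coefa.
apply: (cvg_avg Badm Rcvg Ccontr Jlt JS Jmeas Jprob
  (f := fun k x => g k * sin (2 * pi * dotR (- intv l) x)) (C := 1)).
- by move=> k; apply: continuous_scaler; exact: continuous_sindot.
- by move=> k x; rewrite normrM mulr_ile1 // norm_sin_le1.
Qed.

Lemma cvg_nrm2_coefa l :
  (fun N => nrm2 (coefa m g (intv l) N)) @ \oo --> nrm2 (bessel l).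
Proof.
have cR := @cvg_Re_coefa l; have cI := @cvg_Im_coefa l.
exact: cvgD (cvgM cR cR) (cvgM cI cI).
Qed.

Variable L : seq 'cV[int]_d.

Definition projRe (x : vec) : R :=
  \sum_(l <- L) (complex.Re (bessel l) * cos (2 * pi * dotR (intv l) x)
               - complex.Im (bessel l) * sin (2 * pi * dotR (intv l) x)).

Definition projIm (x : vec) : R :=
  \sum_(l <- L) (complex.Re (bessel l) * sin (2 * pi * dotR (intv l) x)
               + complex.Im (bessel l) * cos (2 * pi * dotR (intv l) x)).

Let A : R := \sum_(l <- L) (`|complex.Re (bessel l)| + `|complex.Im (bessel l)|).

Lemma projRe_bound x : `|projRe x| <= A.
Proof.
apply: le_trans (ler_norm_sum _ _ _) _; apply: ler_sum => l _.
apply: le_trans (ler_normB _ _) _; rewrite !normrM lerD // -[leRHS]mulr1.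
  by rewrite ler_wpM2l // norm_cos_le1.
by rewrite ler_wpM2l // norm_sin_le1.
Qed.

Lemma projIm_bound x : `|projIm x| <= A.
Proof.
apply: le_trans (ler_norm_sum _ _ _) _; apply: ler_sum => l _.
apply: le_trans (ler_normD _ _) _; rewrite !normrM lerD // -[leRHS]mulr1.
  by rewrite ler_wpM2l // norm_sin_le1.
by rewrite ler_wpM2l // norm_cos_le1.
Qed.

Lemma continuous_projRe : continuous projRe.
Proof.
apply: continuous_bigsum => l; apply: continuous_subr; apply: continuous_scaler.
  exact: continuous_cosdot.
exact: continuous_sindot.
Qed.

Lemma continuous_projIm : continuous projIm.
Proof.
apply: continuous_bigsum => l; apply: continuous_addr; apply: continuous_scaler.
  exact: continuous_sindot.
exact: continuous_cosdot.
Qed.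

Definition resid (k : nat) (x : vec) : R :=
  (g k - projRe x) ^+ 2 + projIm x ^+ 2.

Lemma projE x : \sum_(l <- L) bessel l * expi (intv l) x = Complex (projRe x) (projIm x).
Proof. by apply: complex_ext; rewrite (Re_sum, Im_sum); apply: eq_bigr. Qed.

Lemma residE k x :
  resid k x = nrm2 ((g k)%:C%C - \sum_(l <- L) bessel l * expi (intv l) x).
Proof. by rewrite projE /nrm2 /= add0r sqrrN. Qed.

Lemma continuous_resid k : continuous (resid k).
Proof.
have -> : resid k = fun x => (g k - projRe x) * (g k - projRe x) + projIm x * projIm x.
  by apply/funext => x; rewrite /resid !expr2.
have c1 : continuous (fun x => g k - projRe x).
  by apply: continuous_subr; [exact: cst_continuous|exact: continuous_projRe].
by apply: continuous_addr; apply: continuous_mulr => //; exact: continuous_projIm.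
Qed.

Lemma resid_bound k x : `|resid k x| <= (1 + A) ^+ 2 + A ^+ 2.
Proof.
have hI := projIm_bound x.
have hR : `|g k - projRe x| <= 1 + A.
  exact: le_trans (ler_normB _ _) (lerD (g1 k) (projRe_bound x)).
rewrite ger0_norm; last by rewrite addr_ge0 // sqr_ge0.
have sq (u v : R) : `|u| <= v -> u ^+ 2 <= v ^+ 2.
  by move=> uv; rewrite -(real_normK (num_real u)) lerXn2r ?nnegrE // (le_trans _ uv).
by apply: lerD; apply: sq.
Qed.

(** Limit of [avg_dist] along the levels [nn i] with the coefficients [bessel] held fixed; the cross
    term tends to twice the sum of squares. *)
Lemma resid_integral n nn Lt : (forall j, (nn j < nn j.+1)%N) ->
  (forall j, Spec (nn j) (Lt j)) -> (forall j, {subset Lt j <= Lt j.+1}) ->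
  L = Lt n ->
  \int[P]_w resid (J m w) (X w) =
  avg m (fun j => g j ^+ 2) - \sum_(l <- L) nrm2 (bessel l).
Proof.
move=> nnS sL subL LE.
have nnge j : (j <= nn j)%N.
  by elim: j => // j IHj; exact: leq_ltn_trans IHj (nnS j).
have sub j i : (j <= i)%N -> {subset Lt j <= Lt i}.
  move=> /subnK <-; elim: (i - j)%N => [|e IHe] l // /IHe; exact: subL.
have uL : uniq L by rewrite LE; case: (sL n).
have c1 := @cvg_avg _ _ _ _ _ Badm Rcvg Ccontr _ _ _ _ Jlt JS Jmeas Jprob m resid _
  continuous_resid resid_bound.
have {}c1 := @cvg_subseq_nat R nn _ _ nnS c1.
have c2 : (fun i => avg m (fun j => g j ^+ 2) + \sum_(l <- L) (nrm2 (bessel l)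
    - 2 * complex.Re (conjc (bessel l) * coefa m g (intv l) (nn i)))) @ \oo -->
    avg m (fun j => g j ^+ 2) + \sum_(l <- L) (nrm2 (bessel l) - 2 * nrm2 (bessel l)).
  apply: cvgD; first exact: cvg_cst.
  apply: (@cvg_seq_sum R _ L (fun i l => nrm2 (bessel l)
    - 2 * complex.Re (conjc (bessel l) * coefa m g (intv l) (nn i)))) => l.
  apply: cvgB; first exact: cvg_cst.
  apply: cvgM; first exact: cvg_cst.
  have cR := @cvg_subseq_nat R nn _ _ nnS (@cvg_Re_coefa l).
  have cI := @cvg_subseq_nat R nn _ _ nnS (@cvg_Im_coefa l).
  have -> : (fun i => complex.Re (conjc (bessel l) * coefa m g (intv l) (nn i))) =
    (fun i => complex.Re (bessel l) * complex.Re (coefa m g (intv l) (nn i))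
       + complex.Im (bessel l) * complex.Im (coefa m g (intv l) (nn i))).
    apply/funext => i; case: (bessel l) (coefa m g (intv l) (nn i)) => [a b] [a' b'] /=.
    by rewrite mulNr opprK.
  rewrite /nrm2 !expr2.
  by apply: cvgD; apply: cvgM => //; exact: cvg_cst.
have E : avg m (fun j => g j ^+ 2) - \sum_(l <- L) nrm2 (bessel l) =
    avg m (fun j => g j ^+ 2) + \sum_(l <- L) (nrm2 (bessel l) - 2 * nrm2 (bessel l)).
  by rewrite -sumrN; congr (_ + _); apply: eq_bigr => l _; ring.
rewrite E -(cvg_lim (@norm_hausdorff _ _) c2); apply/esym/cvg_lim.
  exact: norm_hausdorff.
apply: cvg_trans c1; apply: near_eq_cvg; exists (maxn m n) => // i mni.
have /andP[mi ni] : (m <= i)%N && (n <= i)%N by rewrite -geq_max; exact: mni.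
have mN : (m <= nn i)%N by exact: leq_trans (nnge i).
have sLi : {subset L <= Lt i} by rewrite LE; exact: sub.
rewrite -[RHS](avg_dist Badm g bessel mN uL sLi (sL i)).
by congr (_ * _); apply: eq_bigr => j _; rewrite residE.
Qed.

End Cylinder.
Section Tower.
Variables (eps : R) (nn : nat -> nat) (L : nat -> seq 'cV[int]_d).
Hypothesis eps0 : 0 < eps.
Hypothesis nnS : forall j, (nn j < nn j.+1)%N.
Hypothesis sL : forall j, Spec (nn j) (L j).
Hypothesis subL : forall j, {subset L j <= L j.+1}.
Hypothesis posL : forall j l, l \in L j.+1 -> forall len,
  eps <= tail_prod (nn j.+1) len (intv l).

Section Orthogonal.
Variables h1 h2 : Om -> R.
Hypotheses (mh1 : measurable_fun setT h1) (mh2 : measurable_fun setT h2).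
Hypothesis ih1 : P.-integrable setT (fun w => (h1 w ^+ 2)%:E).
Hypothesis ih2 : P.-integrable setT (fun w => (h2 w ^+ 2)%:E).
Hypothesis orth : forall j l, l \in L j ->
  \int[P]_w (h1 w * cos (2 * pi * dotR (intv l) (X w))
            + h2 w * sin (2 * pi * dotR (intv l) (X w))) = 0 /\
  \int[P]_w (h2 w * cos (2 * pi * dotR (intv l) (X w))
            - h1 w * sin (2 * pi * dotR (intv l) (X w))) = 0.

Let mJX m (f : nat -> vec -> R) : (forall k, continuous (f k)) ->
  measurable_fun setT (fun w => f (J m w) (X w)).
Proof. by move=> cf; exact: (measurable_JX Badm Rcvg Ccontr JS Jmeas m cf). Qed.

Let mX (f : vec -> R) : continuous f -> measurable_fun setT (fun w => f (X w)).
Proof. by move=> cf; apply: (mJX 0 (f := fun=> f)). Qed.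

Let i1 : intg h1. Proof. exact: integrable_of_sqr. Qed.
Let i2 : intg h2. Proof. exact: integrable_of_sqr. Qed.

Let icos (h : Om -> R) l : intg h ->
  intg (fun w => h w * cos (2 * pi * dotR (intv l) (X w))).
Proof.
move=> ih; apply: (@integrableM_bounded _ _ _ P 1 h) => //.
  exact: (mX (@continuous_cosdot R d (intv l))).
by move=> w; exact: norm_cos_le1.
Qed.

Let isin (h : Om -> R) l : intg h ->
  intg (fun w => h w * sin (2 * pi * dotR (intv l) (X w))).
Proof.
move=> ih; apply: (@integrableM_bounded _ _ _ P 1 h) => //.
  exact: (mX (@continuous_sindot R d (intv l))).
by move=> w; exact: norm_sin_le1.
Qed.

Lemma proj_orth j m g :
  let pR := projRe m g (L j) in let pI := projIm m g (L j) in
  intg (fun w => h1 w * pR (X w) + h2 w * pI (X w)) /\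
  \int[P]_w (h1 w * pR (X w) + h2 w * pI (X w)) = 0.
Proof.
move=> pR pI.
(* Real part of the conjugate of [bessel m g l] times [h1 + i h2] times the conjugate
   exponential. *)
pose K l w := complex.Re (bessel m g l) *
    (h1 w * cos (2 * pi * dotR (intv l) (X w))
     + h2 w * sin (2 * pi * dotR (intv l) (X w)))
  + complex.Im (bessel m g l) *
    (h2 w * cos (2 * pi * dotR (intv l) (X w))
     - h1 w * sin (2 * pi * dotR (intv l) (X w))).
have KE w : h1 w * pR (X w) + h2 w * pI (X w) = \sum_(l <- L j) K l w.
  rewrite /pR /pI /projRe /projIm !mulr_sumr -big_split; apply: eq_bigr => l _.
  by cbv beta; rewrite /K; case: (bessel m g l) => a b; rewrite /=; ring.
have -> : (fun w => h1 w * pR (X w) + h2 w * pI (X w)) =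
    (fun w => \sum_(l <- L j) K l w) by apply/funext => w; exact: KE.
apply: intg_sum0 => l lL; have [zc zs] := orth lL.
have k1 : intg (fun w => h1 w * cos (2 * pi * dotR (intv l) (X w))
     + h2 w * sin (2 * pi * dotR (intv l) (X w))).
  by apply: intg_D; [exact: icos|exact: isin].
have k2 : intg (fun w => h2 w * cos (2 * pi * dotR (intv l) (X w))
     - h1 w * sin (2 * pi * dotR (intv l) (X w))).
  by apply: intg_B; [exact: icos|exact: isin].
split; first by apply: intg_D; exact: intg_Z.
rewrite /K RintegralD //; [|exact: intg_Z|exact: intg_Z].
by rewrite !RintegralZl // zc zs !mulr0 addr0.
Qed.

(** Subtracting the projection does not change the integral, and the residual has arbitrarily small
    square integral by [parseval_limit]. *)
Lemma orth_cylinder m g : (forall k, `|g k| <= 1) ->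
  \int[P]_w (h1 w * g (J m w)) = 0.
Proof.
move=> g1; apply/eqP; rewrite -normr_le0; apply/ler_addgt0Pr => e e0; rewrite add0r.
pose H := \int[P]_w (h1 w ^+ 2 + h2 w ^+ 2).
have iH : intg (fun w => h1 w ^+ 2 + h2 w ^+ 2) by exact: intg_D.
have H0 : 0 <= H.
  by apply: Rintegral_ge0 => w _; rewrite addr_ge0 // sqr_ge0.
(* Makes [tau * H] at most [e / 2]; the residual is then taken below [tau * e / 2]. The added 1
   covers [H = 0]. *)
pose tau := e / (2 * (H + 1)).
have tau0 : 0 < tau by rewrite divr_gt0 // mulr_gt0 // ltr_wpDl.
have [j jP] : exists j, avg m (fun j => g j ^+ 2) - tau * e / 2 <=
    \sum_(l <- L j) nrm2 (bessel m g l).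
  apply: (parseval_limit Badm eps0 nnS sL subL posL).
    by move=> l; exact: cvg_nrm2_coefa.
  by rewrite divr_gt0 // mulr_gt0.
pose pR := projRe m g (L j); pose pI := projIm m g (L j).
pose q := resid m g (L j).
have Dle : \int[P]_w q (J m w) (X w) <= tau * e / 2.
  by rewrite (@resid_integral m g g1 (L j) j nn L nnS sL subL erefl); lra.
have iq : intg (fun w => q (J m w) (X w)).
  by apply: (integrable_JX Badm Rcvg Ccontr P JS Jmeas m (C := _));
    [exact: continuous_resid|exact: resid_bound].
have ig : intg (fun w => h1 w * g (J m w)).
  apply: (@integrableM_bounded _ _ _ P 1 h1) => //.
  exact: (measurable_J Jmeas m g).
have [ip zp] := proj_orth j m g.
pose F w := h1 w * g (J m w) - (h1 w * pR (X w) + h2 w * pI (X w)).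
have iF : intg F by exact: intg_B.
have -> : \int[P]_w (h1 w * g (J m w)) = \int[P]_w F w.
  by rewrite /F RintegralB // zp subr0.
apply: le_trans (le_normr_Rintegral _ iF) _ => //.
pose Bd w := tau * (h1 w ^+ 2 + h2 w ^+ 2) + tau^-1 * q (J m w) (X w).
have iB : intg Bd by apply: intg_D; exact: intg_Z.
apply: le_trans (_ : \int[P]_w Bd w <= _).
  apply: le_Rintegral => //; first exact: integrable_norm.
  move=> w _; rewrite /F /Bd /q /resid -/pR -/pI.
  have -> : h1 w * g (J m w) - (h1 w * pR (X w) + h2 w * pI (X w)) =
     h1 w * (g (J m w) - pR (X w)) - h2 w * pI (X w) by ring.
  exact: amgm2.
rewrite /Bd RintegralD //; [|exact: intg_Z|exact: intg_Z].
rewrite !RintegralZl // -/H.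
have h1' : tau * H <= e / 2.
  have -> : e / 2 = tau * (H + 1).
    by rewrite /tau; field; rewrite gt_eqF // ltr_wpDl.
  by rewrite ler_pM2l // lerDl.
have h2' : tau^-1 * \int[P]_w q (J m w) (X w) <= e / 2.
  by rewrite ler_pdivrMl // mulrA.
by lra.
Qed.

(** The cylinder indicators converge pointwise to that of [X^-1(U)]: they are eventually 1 inside
    and always 0 outside. Dominated convergence applies with bound [|h1|]. *)
Lemma orth_open (U : set vec) : open U ->
  (\int[P]_(w in X @^-1` U) (h1 w)%:E)%E = 0%E.
Proof.
move=> oU; have [A [A1 A2]] := open_cylinders Badm Rcvg Ccontr JS oU.
pose g n k : R := (`[< A n k >])%:R.
have g1 n k : `|g n k| <= 1 by rewrite /g; case: `[< _ >]; rewrite (normr1, normr0).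
rewrite integral_mkcond.
pose hn n w := (h1 w * g n (J n w))%:E.
have ih n : intg (fun w => h1 w * g n (J n w)).
  apply: (@integrableM_bounded _ _ _ P 1 h1) => //.
  exact: (measurable_J Jmeas n (g n)).
have cv : (fun n => (\int[P]_w hn n w)%E) @ \oo -->
    (\int[P]_w (((EFin \o h1) \_ (X @^-1` U)) w))%E.
  apply: (@dominated_cvg _ _ _ P setT measurableT hn _ (fun w => `|h1 w|%:E)) => //.
  - by move=> n; exact: (measurable_int P (ih n)).
  - move=> w _; apply: cvg_near_cst; rewrite patchE.
    case: (pselect (U (X w))) => Uw.
      have [N NP] := A2 w Uw; exists N => // n /= /NP An.
      by rewrite /hn /g asboolT // mulr1 ifT // inE.
    apply: nearW => n; rewrite /hn /g asboolF ?mulr0.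
      by rewrite ifF //; apply/negbTE; rewrite notin_setE.
    by move=> /A1.
  - exact: integrable_norm.
  - move=> n w _; rewrite /hn /= lee_fin normrM -[leRHS]mulr1.
    by rewrite ler_wpM2l.
have z n : (\int[P]_w hn n w)%E = 0%E.
  by rewrite [LHS]Rintegral_EFin // orth_cylinder.
have cv0 : (fun n => (\int[P]_w hn n w)%E) @ \oo --> 0%E.
  by under eq_fun do rewrite z; exact: cvg_cst.
by rewrite -(cvg_lim _ cv) // (cvg_lim _ cv0).
Qed.

End Orthogonal.
End Tower.
End Completeness.

(** * Uniform digits on the unit interval *)

Section UniformDigits.
Variable R : realType.

Definition unif : set R -> \bar R :=
  mrestr (@lebesgue_measure R) (measurable_itv `[0%R, 1%R[).

Let unif0 : unif set0 = 0%E.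
Proof. exact: measure0. Qed.

Let unif_ge0 A : (0 <= unif A)%E.
Proof. exact: measure_ge0. Qed.

Let unif_sigma_additive : semi_sigma_additive unif.
Proof.
exact: (@measure_semi_sigma_additive _ _ R
  (mrestr (@lebesgue_measure R) (measurable_itv `[0%R, 1%R[))).
Qed.

HB.instance Definition _ := isMeasure.Build _ _ _ unif
  unif0 unif_ge0 unif_sigma_additive.

Lemma unif_setT : unif setT = 1%E.
Proof.
rewrite /unif /mrestr setTI lebesgue_measure_itv /= lte_fin ltr01.
by rewrite -EFinB subr0.
Qed.

HB.instance Definition _ := Measure_isProbability.Build _ _ _ unif unif_setT.

(** The value 0 off [[0, 1[], a null set for [unif], keeps the index below [N] at every point. *)
Definition digit_index (N : nat) (w : R) : nat :=
  if 0 <= w < 1 then Num.truncn (N%:R * w) else 0%N.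

Lemma digit_index_lt N w : (0 < N)%N -> (digit_index N w < N)%N.
Proof.
move=> N0; rewrite /digit_index; case: ifP => // /andP[w0 w1].
rewrite truncn_lt_nat ?mulr_ge0 // -[ltRHS]mulr1 ltr_pM2l // ltr0n.
exact: N0.
Qed.

Lemma digit_index_div N b w : (0 < b)%N ->
  digit_index N w = (digit_index (N * b) w %/ b)%N.
Proof.
move=> b0; rewrite /digit_index; case: ifP => [/andP[w0 w1]|_]; last by rewrite div0n.
have x0 : 0 <= (N * b)%:R * w by rewrite mulr_ge0.
have /andP[t1 t2] := truncn_itv x0; set t := Num.truncn _ in t1 t2 *.
have b0' : 0 < b%:R :> R by rewrite ltr0n.
apply: truncn_def; apply/andP; split.
  rewrite -(ler_pM2r b0') -natrM mulrAC -natrM (le_trans _ t1) // ler_nat.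
  exact: leq_divM.
rewrite -(ltr_pM2r b0') -natrM mulrAC -natrM (lt_le_trans t2) // ler_nat.
by rewrite ltn_ceil.
Qed.

Lemma digit_index_preimage N k : (0 < N)%N -> (k < N)%N ->
  digit_index N @^-1` [set k] `&` `[0%R, 1%R[ =
  `[k%:R / N%:R, k.+1%:R / N%:R[%classic :> set R.
Proof.
move=> N0 kN; have N0' : 0 < N%:R :> R by rewrite ltr0n.
apply/seteqP; split => w /=; rewrite !in_itv /=.
  move=> [+ w01]; rewrite /digit_index w01 => tk.
  have /andP[w0 w1] := w01.
  have /truncn_itv : 0 <= N%:R * w by rewrite mulr_ge0.
  by rewrite tk ler_pdivrMr // ltr_pdivlMr // ![w * _]mulrC.
rewrite ler_pdivrMr // ltr_pdivlMr // ![w * _]mulrC => /andP[h1 h2].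
have w0 : 0 <= w by rewrite -(pmulr_rge0 _ N0') (le_trans _ h1).
have w1 : w < 1.
  by rewrite -(ltr_pM2l N0') mulr1 (lt_le_trans h2) // ler_nat.
split; last by rewrite w0.
by rewrite /digit_index w0 w1; apply: truncn_def; rewrite h1.
Qed.

Lemma digit_index_measurable N (A : set nat) : (0 < N)%N ->
  measurable (digit_index N @^-1` A).
Proof.
move=> N0.
have -> : digit_index N @^-1` A = \bigcup_(k in A) (digit_index N @^-1` [set k]).
  apply/seteqP; split => w /=; first by move=> Aw; exists (digit_index N w).
  by move=> [k Ak /= ->].
apply: bigcup_measurable => k _.
have mI : measurable (`[0%R, 1%R[%classic : set R) by exact: measurable_itv.
case: (ltnP k N) => kN; last first.
  rewrite (_ : _ @^-1` _ = set0) //; apply/seteqP; split => w //= wk.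
  by move: (digit_index_lt w N0); rewrite wk ltnNge kN.
rewrite -[X in measurable X](setUIDK _ `[0%R, 1%R[%classic).
apply: measurableU; first by rewrite digit_index_preimage //; exact: measurable_itv.
(* Index 0 also collects everything outside the unit interval. *)
case: (eqVneq k 0%N) => k0.
  rewrite (_ : _ `\` _ = ~` `[0%R, 1%R[%classic); first exact: measurableC.
  apply/seteqP; split => w /=; first by case.
  rewrite in_itv /= => w01; split => //.
  by rewrite /digit_index ifF ?k0 //; apply/negbTE/negP.
rewrite (_ : _ `\` _ = set0) //; apply/seteqP; split => w //=.
rewrite in_itv /= => -[wk w01]; move: wk; rewrite /digit_index ifF.
  by move=> /esym/eqP; rewrite (negbTE k0).
by apply/negbTE/negP.
Qed.

Lemma digit_index_prob N k : (0 < N)%N -> (k < N)%N ->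
  unif (digit_index N @^-1` [set k]) = (N%:R^-1)%:E.
Proof.
move=> N0 kN; rewrite /unif /mrestr digit_index_preimage //.
have N0' : 0 < N%:R :> R by rewrite ltr0n.
rewrite lebesgue_measure_itv /= lte_fin ltr_pM2r ?invr_gt0 // ltr_nat ltnSn.
by rewrite -EFinB -mulrBl -natr1 addrC addKr mul1r.
Qed.

End UniformDigits.

(** Open sets are stable under intersection, so Dynkin induction extends the vanishing to all Borel
    sets. *)
Lemma ae_zero_of_open (R : realType) (d : nat) (mu : probability (borelRd R d) R)
    (u : borelRd R d -> R) :
  mu.-integrable setT (EFin \o u) ->
  (forall U : set (vecR R d), open U -> (\int[mu]_(x in U) (u x)%:E)%E = 0%E) ->
  {ae mu, forall x, u x = 0}.
Proof.
move=> iu zU.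
have mu0 S : measurable S -> (\int[mu]_(x in S) (u x)%:E)%E = 0%E.
  apply: (@dynkin_induction _ (borelRd R d) (@open (vecR R d))
    (fun S => (\int[mu]_(x in S) (u x)%:E)%E = 0%E)) => //.
  - by move=> A B; exact: openI.
  - exact: (zU setT openT).
  - move=> T mT zT; have := zU setT openT; rewrite -(setUv T) integral_setU //.
    + by rewrite zT add0e.
    + exact: measurableC.
    + by rewrite setUv; exact: (measurable_int mu iu).
    + by apply/disj_setPCl.
  - move=> F mF tF zF; rewrite integral_bigcup //.
      by rewrite eseries0.
    apply: integrableS iu => //; exact: bigcupT_measurable.
have : ae_eq mu setT (EFin \o u) (cst 0%E).
  apply: integral_ae_eq => // E _ mE; rewrite mu0 // integral0_eq //.
by apply: filterS => x /(_ Logic.I) /= [].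
Qed.

(** * The law of the limit variable and its spectrum *)

Section Law.
Variables (R : realType) (d : nat).
Variables (Rs : nat -> 'M[int]_d) (Bs : nat -> seq 'cV[int]_d) (t0 : vecR R d).
Hypothesis Badm : forall n, admissible R (Rs n) (Bs n).
Hypothesis Rcvg : (fun n => `| invmx (cumR R Rs n.+1) |) @ \oo --> (0 : R).
Hypothesis Ccontr :
  forall n b, b \in Bs n -> contr (Rs n) b @` cube t0 `<=` cube t0.

Local Notation vec := (vecR R d).
Local Notation intv := (@intv R d).
Local Notation P := (@unif R).
Local Notation J := (fun n (w : R) => digit_index (Nn Bs n) w).
Local Notation X := (X R Rs Bs J).
Local Notation Spec := (Spec R Rs Bs).
Local Notation tail_prod := (tail_prod Rs Bs).
Local Notation intg f := (P.-integrable setT (EFin \o f)).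

Let Jlt n w : (J n w < Nn Bs n)%N.
Proof. exact: digit_index_lt (Nn_gt0 Badm n). Qed.

Let JS n w : J n w = (J n.+1 w %/ bsz Bs n)%N.
Proof. by rewrite /= NnS -digit_index_div // (bsz_gt0 Badm). Qed.

Let Jmeas n (A : set nat) : measurable (J n @^-1` A).
Proof. exact: digit_index_measurable (Nn_gt0 Badm n). Qed.

Let Jprob n j : (j < Nn Bs n)%N -> P (J n @^-1` [set j]) = ((Nn Bs n)%:R^-1)%:E.
Proof. exact: digit_index_prob (Nn_gt0 Badm n). Qed.

Let mX : measurable_fun setT (X : R -> borelRd R d).
Proof. exact: (measurable_X Badm Rcvg Ccontr JS Jmeas). Qed.

Let Xm : {mfun R >-> borelRd R d} :=
  MeasurableFun.Pack (MeasurableFun.Class (isMeasurableFun.Build _ _ _ _ _ mX)).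

Definition law : probability (borelRd R d) R := distribution P Xm.

Lemma law_integral (D : set vec) (f : vec -> R) :
  measurable (D : set (borelRd R d)) ->
  measurable_fun setT (f : borelRd R d -> R) -> intg (fun w => f (X w)) ->
  (\int[law]_(x in D) (f x)%:E)%E = (\int[P]_(w in X @^-1` D) (f (X w))%:E)%E.
Proof.
move=> mD mf fi; apply: (integral_pushforward mX) => //.
  exact/measurable_EFinP.
apply: integrableS fi => //; rewrite -[X in measurable X]setTI; exact: mX.
Qed.

Lemma law_integrable (f : vec -> R) :
  measurable_fun setT (f : borelRd R d -> R) ->
  law.-integrable setT (fun x => (f x)%:E) -> intg (fun w => f (X w)).
Proof.
move=> mf /integrableP[_ fi]; apply/integrableP; split.
  by apply/measurable_EFinP; exact: measurableT_comp mf mX.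
move: fi; rewrite (ge0_integral_distribution Xm) //.
by apply/measurable_EFinP; apply: measurableT_comp.
Qed.

Lemma law_weak_limit : conv_weakly_to Rs Bs law.
Proof.
move=> f cf [C fC].
have E n : conv_integral Rs Bs n f = avg Bs n (fun j => f (xpt R Rs Bs n j)).
  by rewrite /conv_integral size_conv_pts sum_conv_pts.
rewrite law_integral //; first last.
- apply: (@bounded_integrable _ _ _ P C) => // .
  by apply: measurableT_comp mX; exact: continuous_borel_measurable.
- exact: continuous_borel_measurable.
rewrite preimage_setT; under eq_fun do rewrite E.
have := cvg_avg_ereal Badm Rcvg Ccontr Jlt JS Jmeas Jprob (m := 0) (f := fun=> f)
  (fun=> cf) (fun=> fC).
by move=> h; apply: (cvg_comp _ _ _ h); apply/cvgnyPge => A; exists A => // n /= /leqW.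
Qed.

Section LawSpectrum.
Variables (eps : R) (nn : nat -> nat) (L : nat -> seq 'cV[int]_d).
Hypothesis eps0 : 0 < eps.
Hypothesis nnS : forall j, (nn j < nn j.+1)%N.
Hypothesis sL : forall j, Spec (nn j) (L j).
Hypothesis subL : forall j, {subset L j <= L j.+1}.
Hypothesis posL : forall j l, l \in L j.+1 -> forall len,
  eps <= tail_prod (nn j.+1) len (intv l).

Definition spectrum : set vec := [set x | exists j l, l \in L j /\ x = intv l].

Let subLL j i : (j <= i)%N -> {subset L j <= L i}.
Proof. by move=> /subnK <-; elim: (i - j)%N => [|e IHe] l // /IHe; exact: subL. Qed.

Lemma countable_spectrum : countable spectrum.
Proof.
apply: (@sub_countable _ _ _ (range intv)).
  by apply: subset_card_le => x [j [l [_ ->]]]; exists l.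
by apply: card_le_trans (card_image_le _ _) _; exact: countableP.
Qed.

(** Orthogonality at finite levels is exact, so the averages are eventually constant along [nn], and
    the limit may be taken there. *)
Lemma law_integral_cvg (f : vec -> R) (C c : R) (j : nat) : continuous f ->
  (forall x, `|f x| <= C) ->
  (forall i, (j <= i)%N -> avg Bs (nn i) (fun k => f (xpt R Rs Bs (nn i) k)) = c) ->
  (\int[law]_x (f x)%:E)%E = c%:E.
Proof.
move=> cf fC fc.
have iX : intg (fun w => f (X w)).
  apply: (@bounded_integrable _ _ _ P C) => //.
  by apply: measurableT_comp mX; exact: continuous_borel_measurable.
rewrite law_integral //; last exact: continuous_borel_measurable.
rewrite preimage_setT Rintegral_EFin //; congr (_%:E).
have cv := cvg_avg Badm Rcvg Ccontr Jlt JS Jmeas Jprob (m := 0) (f := fun=> f)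
  (fun=> cf) (fun=> fC).
have {}cv := @cvg_subseq_nat R nn _ _ nnS cv.
rewrite -(cvg_lim (@norm_hausdorff _ _) cv); apply: cvg_lim.
  exact: norm_hausdorff.
by apply: cvg_near_cst; exists j => // i /= /fc.
Qed.

Lemma spectrum_orthonormal l l' : spectrum l -> spectrum l' ->
  (\int[law]_x (cos (2 * pi * dotR (l - l') x))%:E)%E = (if l == l' then 1 else 0)%:E
  /\ (\int[law]_x (sin (2 * pi * dotR (l - l') x))%:E)%E = 0%E.
Proof.
move=> [j [a [aL ->]]] [j' [a' [a'L ->]]].
have N0 n : (Nn Bs n)%:R != 0 :> R by rewrite pnatr_eq0 -lt0n (Nn_gt0 Badm).
have E i : (maxn j j' <= i)%N ->
    \sum_(0 <= k < Nn Bs (nn i)) expi (intv a - intv a') (xpt R Rs Bs (nn i) k) =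
    (if a == a' then (Nn Bs (nn i))%:R else 0).
  rewrite geq_max => /andP[ji j'i]; case: (sL i) => _ oL _; apply: oL.
    exact: subLL ji _ aL.
  exact: subLL j'i _ a'L.
rewrite (inj_eq (@intv_inj R d)); split.
- apply: (@law_integral_cvg _ 1 _ (maxn j j')).
  + exact: continuous_cosdot.
  + by move=> x; exact: norm_cos_le1.
  + move=> i /E /(congr1 (@complex.Re R)); rewrite Re_sum /avg => ->.
    by case: ifP => _; rewrite ?natrC /= ?mulr0 // mulVf.
- apply: (@law_integral_cvg _ 1 0 (maxn j j')).
  + exact: continuous_sindot.
  + by move=> x; exact: norm_sin_le1.
  + move=> i /E /(congr1 (@complex.Im R)); rewrite Im_sum /avg => ->.
    by case: ifP => _; rewrite ?natrC /= ?mulr0.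
Qed.

Lemma law_orth_zero (u v : vec -> R) : L2R law u -> L2R law v ->
  (forall l, spectrum l ->
    (\int[law]_x (u x * cos (2 * pi * dotR l x) + v x * sin (2 * pi * dotR l x))%:E)%E
      = 0%E /\
    (\int[law]_x (v x * cos (2 * pi * dotR l x) - u x * sin (2 * pi * dotR l x))%:E)%E
      = 0%E) ->
  {ae law, forall x, u x = 0} /\ {ae law, forall x, v x = 0}.
Proof.
move=> [mu iu] [mv iv] orth.
have mc l : measurable_fun setT
    ((fun x : vec => cos (2 * pi * dotR l x)) : borelRd R d -> R).
  by apply: continuous_borel_measurable; exact: continuous_cosdot.
have ms l : measurable_fun setT
    ((fun x : vec => sin (2 * pi * dotR l x)) : borelRd R d -> R).
  by apply: continuous_borel_measurable; exact: continuous_sindot.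
pose h1 w := u (X w); pose h2 w := v (X w).
have mh1 : measurable_fun setT h1 by exact: measurableT_comp mu mX.
have mh2 : measurable_fun setT h2 by exact: measurableT_comp mv mX.
have ih1 : P.-integrable setT (fun w => (h1 w ^+ 2)%:E).
  by apply: (law_integrable (f := fun x => u x ^+ 2)) => //; exact: measurable_funX.
have ih2 : P.-integrable setT (fun w => (h2 w ^+ 2)%:E).
  by apply: (law_integrable (f := fun x => v x ^+ 2)) => //; exact: measurable_funX.
have i1 : intg h1 by exact: integrable_of_sqr.
have i2 : intg h2 by exact: integrable_of_sqr.
have ic (h : R -> R) l : intg h -> intg (fun w => h w * cos (2 * pi * dotR l (X w))).
  move=> ih; apply: (@integrableM_bounded _ _ _ P 1 h) => //.
    exact: measurableT_comp (mc l) mX.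
  by move=> w; exact: norm_cos_le1.
have is_ (h : R -> R) l : intg h -> intg (fun w => h w * sin (2 * pi * dotR l (X w))).
  move=> ih; apply: (@integrableM_bounded _ _ _ P 1 h) => //.
    exact: measurableT_comp (ms l) mX.
  by move=> w; exact: norm_sin_le1.
have orthP j l : l \in L j ->
    \int[P]_w (h1 w * cos (2 * pi * dotR (intv l) (X w))
            + h2 w * sin (2 * pi * dotR (intv l) (X w))) = 0 /\
    \int[P]_w (h2 w * cos (2 * pi * dotR (intv l) (X w))
            - h1 w * sin (2 * pi * dotR (intv l) (X w))) = 0.
  move=> lL; have [|zc zs] := orth (intv l); first by exists j, l.
  move: zc zs; rewrite !law_integral //; first last.
  - by apply: intg_D; [exact: ic|exact: is_].
  - by apply: measurable_funD; apply: measurable_funM.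
  - by apply: intg_B; [exact: ic|exact: is_].
  - by apply: measurable_funB; apply: measurable_funM.
  by rewrite preimage_setT /Rintegral => -> ->.
(* Multiplying [h1 + i h2] by [-i] gives the pair [(h2, - h1)], still orthogonal; the result on the
   first component then covers [v]. *)
have orthN j l : l \in L j ->
    \int[P]_w (h2 w * cos (2 * pi * dotR (intv l) (X w))
            + (- h1 w) * sin (2 * pi * dotR (intv l) (X w))) = 0 /\
    \int[P]_w ((- h1 w) * cos (2 * pi * dotR (intv l) (X w))
            - h2 w * sin (2 * pi * dotR (intv l) (X w))) = 0.
  move=> /orthP[zc zs]; split; first by under eq_Rintegral do rewrite mulNr.
  under eq_Rintegral do rewrite mulNr -opprD -mulN1r.
  by rewrite RintegralZl ?zc ?mulr0 //; apply: intg_D; [exact: ic|exact: is_].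
have mNh1 : measurable_fun setT (fun w => - h1 w) by exact: measurable_funN.
have iNh1 : P.-integrable setT (fun w => ((- h1 w) ^+ 2)%:E).
  by under eq_fun do rewrite sqrrN.
split; apply: ae_zero_of_open; try exact: integrable_of_sqr.
- move=> U oU; rewrite law_integral //; last exact: borel_open.
  exact: (orth_open Badm Rcvg Ccontr Jlt JS Jmeas Jprob eps0 nnS sL subL posL
    mh1 mh2 ih1 ih2 orthP).
- move=> U oU; rewrite law_integral //; last exact: borel_open.
  exact: (orth_open Badm Rcvg Ccontr Jlt JS Jmeas Jprob eps0 nnS sL subL posL
    mh2 mNh1 ih2 iNh1 orthN).
Qed.

Lemma spectrum_basis : orthonormal_basis_exp law spectrum.
Proof.
by split; [exact: spectrum_orthonormal|move=> u v; exact: law_orth_zero].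
Qed.

End LawSpectrum.
End Law.

Theorem theorem1p5 (R : realType) (d : nat)
    (Rs : nat -> 'M[int]_d) (Bs : nat -> seq 'cV[int]_d) (t0 : vecR R d) :
  (forall n, admissible R (Rs n) (Bs n)) ->
  (* (i) ||R_1^{-1} ... R_n^{-1}|| -> 0 *)
  (fun n => `| invmx (cumR R Rs n.+1) |) @ \oo --> (0 : R) ->
  (* (ii) *)
  (forall n b, b \in Bs n -> contr (Rs n) b @` cube t0 `<=` cube t0) ->
  (* (iii) *)
  (exists (M : 'M[int]_d) (B : seq 'cV[int]_d),
     [/\ admissible R M B,
         (forall N, exists2 n, (N <= n)%N & Rs n = M /\ Bs n =i B) &
         exists2 b0, b0 \in B &
           contr M b0 @` cube t0 `<=` interior (cube t0)]) ->
  exists mu : probability (borelRd R d) R,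
    conv_weakly_to Rs Bs mu /\ spectral_with_integer_spectrum mu.
Proof.
move=> Badm Rcvg Ccontr [M [B [_ often [b0 b0B b0int]]]].
have [eps [nn [L [eps0 nnS sL subL posL]]]] :=
  spectrum_tower Badm Rcvg Ccontr often b0B b0int.
exists (law Badm Rcvg Ccontr); split; first exact: law_weak_limit.
exists (@spectrum R d L); split; first exact: countable_spectrum.
split; first by move=> _ [j [l [_ ->]]]; exists l.
exact: (spectrum_basis _ _ _ eps0 nnS sL subL posL).
Qed.
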